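(* For a positive integer $n$, let $N(n)$ denote the number of distinct Steiner quadruple systems on a fixed $n$-element point set $X$, i.e. the number of collections $B$ of $4$-element subsets of $X$ such that every $3$-element subset of $X$ is contained in exactly one member of $B$. Then $\ln N(n)=\Theta(n^3\ln n)$ as $n\to\infty$ with $n\equiv 2 \pmod 6$ or $n\equiv 4\pmod 6$; that is, there exist constants $c_2\ge c_1>0$ and $n_0$ such that $c_1 n^3\ln n\le \ln N(n)\le c_2 n^3\ln n$ for all $n\ge n_0$ with $n\equiv 2$ or $4 \pmod 6$.
   Context: A Steiner quadruple system $SQS(n)$ (also written $S(3,4,n)$) is a pair $(X,B)$ with $|X|=n$ and $B$ a collection of $4$-element subsets (blocks) of $X$ such that every $3$-subset of $X$ lies in exactly one block. *)

(* Defs.v *)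
From mathcomp Require Import all_boot.
Set Implicit Arguments. Unset Strict Implicit. Unset Printing Implicit Defensive.

Definition is_SQS (n : nat) (B : {set {set 'I_n}}) : bool :=
  [forall b in B, #|b| == 4] &&
  [forall T : {set 'I_n}, (#|T| == 3) ==> (#|[set b in B | T \subset b]| == 1)].

Definition num_SQS (n : nat) : nat := #|[set B : {set {set 'I_n}} | is_SQS B]|.

(* Main.v *)
(* The upper bound holds because a system is a map from triples to fourth points. For the lower
   bound, every admissible order has a system containing four disjoint [k]-sets, [k] of order [n /
   720], whose transversal triples are covered by transversal blocks, i.e. by a Latin cube of order
   [k]; this cube can be replaced by any other one. With [k = 2 ^ a * b], perturbing the cube [x +
   y + z] of the group [Z_2 ^ a * Z_b] on disjoint cosets of subgroups [{0, d} ^ 3] yields [k ^ (c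
   * k ^ 3)] Latin cubes. Systems with such a cube are built recursively, for all orders, from
   systems on fewer points: [2 u], [4 u - 6], [3 u - 2], [3 u - 4], [3 u - 8] and [12 u - 10]
   points from [u] points. In each construction it suffices to count the blocks and to check that
   they cover all triples. *)
Require Import Defs.
From Stdlib Require Import Reals.
Open Scope R_scope.
From Stdlib Require Import Lra Lia.
From mathcomp Require all_boot all_algebra zify.

(* MathComp is imported only inside this module, since its notations would change the reading
   of the theorem. *)
Module Designs.
Import all_boot all_algebra zify.
Local Open Scope nat_scope.
Import GRing.Theory.
Set Implicit Arguments. Unset Strict Implicit. Unset Printing Implicit Defensive.

(** * Steiner quadruple systems and transversal cubes *)

(** The recursions are Hanani's; the difficulty is to make each of them produce or keep a large
    Latin cube. Two quantities must stay under control. The ratio n / k has to be bounded, because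
    about k ^ 3 / 128 cosets get perturbed; and 2 ^ a has to exceed a fixed power of n, because the
    number of choices per coset supplies the factor ln n. For 2u and 4u - 6 the cube is created
    afresh, with ratios at most 32 and 80, from a one-factorization containing a Latin subsquare
    whose side is a power of two. The steps to 3u - 4 and 3u - 8 only contain the old system and
    multiply the ratio by 3; at most two of them are chained to carry a cube, and 720 = 80 * 3 * 3.
    Weighting by 3 or 12 multiplies k along with n, so 12u - 10 can be iterated without limit: it
    multiplies 2 ^ a by 4 and its cofactor by only 3. *)

Definition is_sqs (T : finType) (B : {set {set T}}) : bool :=
  [forall b in B, #|b| == 4] &&
  [forall A : {set T}, (#|A| == 3) ==> (#|[set b in B | A \subset b]| == 1)].

Definition covers (T I : finType) (v : I -> {set T}) : Prop :=
  forall x y z, x != y -> x != z -> y != z ->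
    exists i, [&& x \in v i, y \in v i & z \in v i].

Definition quad (T : finType) (x y z w : T) : {set T} := [set x; y; z; w].

Lemma card_quad_le (T : finType) (x y z w : T) : #|quad x y z w| <= 4.
Proof.
by rewrite /quad !cardsU !cards1; lia.
Qed.

Lemma bin3E n : 'C(n, 3) * 6 = n * n.-1 * n.-2.
Proof. by rewrite -[6]/(3`!) bin_ffact ffactnS ffactnS ffactn1 mulnA. Qed.

Lemma cards3 (T : finType) (x y z : T) : x != y -> x != z -> y != z ->
  #|[set x; y; z]| = 3.
Proof.
by move=> xy xz yz; rewrite setUC cardsU1 !inE cards2 xy eq_sym negb_or xz eq_sym yz.
Qed.

Lemma set3P (T : finType) (A : {set T}) : #|A| = 3 ->
  exists x y z, [/\ x != y, x != z, y != z & A = [set x; y; z]].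
Proof.
move=> cA; have : 2 < #|A| by rewrite cA.
case/card_gt2P => x [y [z [[xA yA zA] [xy yz zx]]]].
exists x, y, z; split=> //; first by rewrite eq_sym.
apply/eqP; rewrite eq_sym eqEcard cA; apply/andP; split.
  by apply/subsetP=> t; rewrite !inE => /orP[/orP[]|] /eqP->.
by rewrite cards3 // eq_sym.
Qed.

Lemma add_tight a b c d : d <= a -> c <= b -> a + b = d + c -> a = d.
Proof. lia. Qed.

Lemma add_tight_le a b c d : a <= d -> b <= c -> a + b = d + c -> a = d.
Proof. lia. Qed.

Section Families.
Variables (T I : finType) (v : I -> {set T}).

(** Double counting of the pairs formed by a [k]-set and a member containing it. *)
Lemma sum_subsets k : \sum_(A : {set T} | #|A| == k) #|[set i | A \subset v i]|
  = \sum_i 'C(#|v i|, k).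
Proof.
have e (A : {set T}) : #|[set i | A \subset v i]| = \sum_i (A \subset v i).
  by rewrite -sum1_card big_mkcond /=; apply: eq_bigr => i _; rewrite inE; case: ifP.
rewrite (eq_bigr _ (fun A _ => e A)).
rewrite exchange_big /=; apply: eq_bigr => i _.
rewrite -cards_draws -sum1_card big_mkcond /= [RHS]big_mkcond /=.
by apply: eq_bigr => A _; rewrite inE; case: (#|A| == k); case: (A \subset v i).
Qed.

Hypotheses (v4 : forall i, #|v i| <= 4) (vc : covers v).
Hypothesis vn : 24 * #|I| <= #|T| * #|T|.-1 * #|T|.-2.

Lemma cover_ge1 (A : {set T}) : #|A| == 3 -> 1 <= #|[set i | A \subset v i]|.
Proof.
move/eqP/set3P=> [x [y [z [xy xz yz ->]]]].
have [i /and3P[xi yi zi]] := vc xy xz yz.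
apply/card_gt0P; exists i; rewrite inE; apply/subsetP=> t.
by rewrite !inE => /orP[/orP[]|] /eqP->.
Qed.

Lemma bin4_le i : 'C(#|v i|, 3) <= 4.
Proof. by have := leq_bin2l 3 (v4 i). Qed.

Lemma triples_le : #|I| * 4 <= 'C(#|T|, 3).
Proof. have := bin3E #|T|; move: vn; lia. Qed.

Lemma card_triples : \sum_(A : {set T} | #|A| == 3) 1 = 'C(#|T|, 3).
Proof. by rewrite sum1_card -card_draws; apply: eq_card => A; rewrite inE. Qed.

(** The chain [#|I| * 4] <= number of triples <= sum of the multiplicities = sum of ['C(#|v i|, 3)]
    <= [#|I| * 4] closes up, so all its terms agree. *)
Lemma tight : \sum_(A : {set T} | #|A| == 3) #|[set i | A \subset v i]|
   = 'C(#|T|, 3) /\ \sum_i 'C(#|v i|, 3) = #|I| * 4.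
Proof.
have h1 : 'C(#|T|, 3) <= \sum_(A : {set T} | #|A| == 3) #|[set i | A \subset v i]|.
  by rewrite -card_triples; apply: leq_sum => A; apply: cover_ge1.
have h2 : \sum_i 'C(#|v i|, 3) <= #|I| * 4.
  by rewrite -sum_nat_const; apply: leq_sum => i _; apply: bin4_le.
have l := triples_le; rewrite sum_subsets in h1 *.
by split; apply/eqP; rewrite eqn_leq ?h1 ?h2 ?(leq_trans h2 l) ?(leq_trans l h1).
Qed.

Lemma tight_cover (A : {set T}) : #|A| == 3 -> #|[set i | A \subset v i]| = 1.
Proof.
move=> A3; have [h _] := tight; move: h.
rewrite -card_triples (bigD1 A) //= [RHS](bigD1 A) //= => h.
have h1 : \sum_(B : {set T} | (#|B| == 3) && (B != A)) 1 <=
   \sum_(B : {set T} | (#|B| == 3) && (B != A)) #|[set i | B \subset v i]|.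
  by apply: leq_sum => B /andP[B3 _]; apply: cover_ge1.
exact: add_tight (cover_ge1 A3) h1 h.
Qed.

Lemma tight_card i : #|v i| = 4.
Proof.
have [_ h] := tight; move: h; rewrite -sum_nat_const (bigD1 i) //= [RHS](bigD1 i) //=.
have h1 : \sum_(j | j != i) 'C(#|v j|, 3) <= \sum_(j | j != i) 4.
  by apply: leq_sum => j _; apply: bin4_le.
move=> h; have : 'C(#|v i|, 3) = 4 by apply: add_tight_le (bin4_le i) h1 h.
by have := v4 i; case: #|v i| => [|[|[|[|[|]]]]].
Qed.

(* A family of few small sets covering all triples covers each of them exactly once, so
   in the constructions below only existence of a block through a triple is checked. *)
Lemma family_sqs : is_sqs [set v i | i : I].
Proof.
apply/andP; split; first by apply/forall_inP=> _ /imsetP[i _ ->]; rewrite tight_card.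
apply/forallP=> A; apply/implyP=> A3.
have /eqP := tight_cover A3; case/cards1P=> i vi.
have Ai : A \subset v i by have := set11 i; rewrite -vi inE.
apply/cards1P; exists (v i); apply/setP=> b; rewrite !inE.
apply/andP/eqP=> [[/imsetP[j _ ->] Aj]|->]; last by split; rewrite ?imset_f.
have : j \in [set i | A \subset v i] by rewrite inE.
by rewrite vi inE => /eqP->.
Qed.

End Families.

Section FromSqs.
Variables (T : finType) (B : {set {set T}}).
Hypothesis sB : is_sqs B.

Lemma sqs_card4 b : b \in B -> #|b| = 4.
Proof. by case/andP: sB => /forall_inP h _ /h/eqP. Qed.

Lemma sqs_unique (A b c : {set T}) : #|A| = 3 -> b \in B -> c \in B ->
  A \subset b -> A \subset c -> b = c.
Proof.
case/andP: sB => _ /forallP/(_ A) /implyP h /eqP/h/cards1P[d dP] bB cB Ab Ac.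
have : b \in [set d] by rewrite -dP inE bB.
have : c \in [set d] by rewrite -dP inE cB.
by rewrite !inE => /eqP-> /eqP->.
Qed.

Lemma sqs_cover x y z : x != y -> x != z -> y != z ->
  exists2 b, b \in B & [&& x \in b, y \in b & z \in b].
Proof.
move=> xy xz yz; case/andP: sB => _ /forallP/(_ [set x; y; z]) /implyP.
rewrite (cards3 xy xz yz) => /(_ isT)/cards1P[d dP].
have : d \in [set d] by rewrite inE.
rewrite -dP inE => /andP[dB /subsetP s]; exists d => //.
by rewrite !s // !inE eqxx ?orbT.
Qed.

Lemma sqs_card : 24 * #|B| = #|T| * #|T|.-1 * #|T|.-2.
Proof.
have := @sum_subsets T {b | b \in B} val 3.
rewrite (eq_bigr (fun=> 4)) => [|b _]; last by rewrite sqs_card4 // (valP b).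
rewrite sum_nat_const card_sig (eq_card (B := B)) // => h.
suff: \sum_(A : {set T} | #|A| == 3) #|[set i : {b | b \in B} | A \subset val i]| = 'C(#|T|, 3).
  by rewrite h => {h} e; have := bin3E #|T|; lia.
rewrite -card_triples; apply: eq_bigr => A A3.
have /andP[_ /forallP/(_ A)/implyP/(_ A3)/eqP <-] := sB.
rewrite -(card_imset _ (@val_inj _ _ {b | b \in B})).
apply: eq_card => b; rewrite !inE; apply/imsetP/andP => [[c]|[bB Ab]].
  by rewrite inE => h1 ->; split=> //; apply: valP.
by exists (exist _ b bB); rewrite ?inE.
Qed.
End FromSqs.

Definition sqs (n : nat) : Prop := exists B : {set {set 'I_n}}, is_sqs B.

(** With an indexed family, a construction is counted on a sum of index types, without proving that
    blocks of different kinds are distinct. *)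
Definition design (T I : finType) (v : I -> {set T}) : Prop :=
  [/\ forall i, #|v i| <= 4, covers v & 24 * #|I| <= #|T| * #|T|.-1 * #|T|.-2].

Lemma design_transport (T T' I : finType) (v : I -> {set T}) (f : T -> T') :
  bijective f -> design v -> design (fun i => f @: v i).
Proof.
move=> bf [v4 vc vn]; have [g fK gK] := bf; split=> [i|x y z xy xz yz|].
- by rewrite card_imset //; apply: can_inj fK.
- have gi := can_inj gK.
  have [|||i /and3P[xi yi zi]] := vc (g x) (g y) (g z); rewrite ?(inj_eq gi) //.
  by exists i; rewrite -[x]gK -[y]gK -[z]gK !imset_f.
- by rewrite -(bij_eq_card bf).
Qed.

Lemma design_sqs (T I : finType) (v : I -> {set T}) n : design v -> #|T| = n -> sqs n.
Proof.
move=> dv Tn; subst n.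
have [v4 vc vn] := design_transport (@enum_rank_bij T) dv.
exists [set enum_rank @: v i | i : I]; exact: family_sqs.
Qed.

Lemma sqs_design n : sqs n -> exists (I : finType) (v : I -> {set 'I_n}),
  [/\ design v, 24 * #|I| = n * n.-1 * n.-2 & forall i, #|v i| = 4].
Proof.
case=> B sB; exists {b | b \in B}, val.
have cI : 24 * #|{: {b | b \in B}}| = n * n.-1 * n.-2.
  by rewrite card_sig (eq_card (B := B)) // (sqs_card sB) card_ord.
split=> //; last by move=> i; rewrite (sqs_card4 sB (valP i)).
split=> [i|x y z xy xz yz|]; first by rewrite (sqs_card4 sB (valP i)).
  by have [b bB h] := sqs_cover sB xy xz yz; exists (exist _ b bB).
by rewrite cI card_ord.
Qed.

Lemma sqs_design_on (T : finType) : sqs #|T| -> exists (I : finType) (v : I -> {set T}),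
  [/\ design v, 24 * #|I| = #|T| * #|T|.-1 * #|T|.-2 & forall i, #|v i| = 4].
Proof.
case/sqs_design=> I [v [dv cI v4]].
exists I, (fun i => enum_val @: v i); split=> //.
  exact: design_transport (enum_val_bij T) dv.
by move=> i; rewrite card_imset //; apply: enum_val_inj.
Qed.

Lemma sorted3_wlog (T : Type) (r : T -> nat) (P : T -> T -> T -> Prop) :
  (forall x y z, P x y z -> P y x z) -> (forall x y z, P x y z -> P x z y) ->
  (forall x y z, r x <= r y <= r z -> P x y z) -> forall x y z, P x y z.
Proof.
move=> p1 p2 h; have h' x y z : r x <= r y -> r x <= r z -> P x y z.
  move=> rxy rxz; case: (leqP (r y) (r z)) => [ryz|/ltnW rzy]; first by apply: h; rewrite rxy.
  by apply: p2; apply: h; rewrite rxz.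
move=> x y z; case: (leqP (r x) (r y)) => [rxy|/ltnW ryx].
  case: (leqP (r x) (r z)) => [rxz|/ltnW rzx]; first exact: h'.
  by apply: p2; apply: p1; apply: h' => //; apply: leq_trans rxy.
case: (leqP (r y) (r z)) => [ryz|/ltnW rzy]; first by apply: p1; apply: h'.
by apply: p2; apply: p1; apply: h' => //; apply: leq_trans rzy ryx.
Qed.

Lemma covers_sorted (T I : finType) (v : I -> {set T}) (r : T -> nat) :
  (forall x y z, x != y -> x != z -> y != z -> r x <= r y <= r z ->
    exists i, [&& x \in v i, y \in v i & z \in v i]) -> covers v.
Proof.
move=> h; apply: (@sorted3_wlog T r) => [x y z H|x y z H|x y z rs] xy xz yz; last exact: h.
  have [|||i /and3P[a b c]] := H; rewrite // 1?eq_sym //.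
  by exists i; rewrite a b c.
have [|||i /and3P[a b c]] := H; rewrite // 1?eq_sym //.
by exists i; rewrite a b c.
Qed.

(* [4 k] points [f (j, _)], [j < 4], such that every transversal of three of the
   [k]-sets extends to a transversal block; they leave out some point. *)
Definition flex (n k : nat) : Prop :=
  exists (B : {set {set 'I_n}}) (f : 'I_4 * 'I_k -> 'I_n) (o : 'I_n),
    [/\ is_sqs B, injective f, forall p, f p != o &
     forall x y z, exists w, quad (f (inord 0, x)) (f (inord 1, y)) (f (inord 2, z)) (f (inord 3, w)) \in B].

Lemma design_flex (T I K : finType) (v : I -> {set T}) (f : 'I_4 * K -> T) (o : T) n k :
  design v -> #|T| = n -> #|K| = k -> injective f -> (forall p, f p != o) ->
  (forall x y z, exists w i, v i = quad (f (inord 0, x)) (f (inord 1, y)) (f (inord 2, z)) (f (inord 3, w))) ->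
  flex n k.
Proof.
move=> dv Tn Kk fi fo fv; subst n k.
have [v4 vc vn] := design_transport (@enum_rank_bij T) dv.
exists [set enum_rank @: v i | i : I], (fun p => enum_rank (f (p.1, enum_val p.2))), (enum_rank o).
split; first exact: family_sqs.
- by move=> [i x] [j y] /= /enum_rank_inj /fi [-> /enum_val_inj ->].
- by move=> p; rewrite (inj_eq enum_rank_inj).
- move=> x y z; have [w [i vi]] := fv (enum_val x) (enum_val y) (enum_val z).
  exists (enum_rank w); rewrite enum_rankK /=; apply/imsetP; exists i => //.
  by rewrite vi /quad !imsetU !imset_set1.
Qed.

(** * One-factorizations *)

Lemma card_bij (A B : finType) : #|A| = #|B| -> exists f : A -> B, bijective f.
Proof.
move=> e; exists (fun x => enum_val (cast_ord e (enum_rank x))).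
exists (fun y => enum_val (cast_ord (esym e) (enum_rank y))) => x.
  by rewrite enum_valK cast_ordK enum_rankK.
by rewrite enum_valK cast_ordKV enum_rankK.
Qed.

Lemma card_set_sum (U : finType) (P : pred U) : #|[set x | P x]| = \sum_x P x.
Proof.
by rewrite -sum1_card big_mkcond /=; apply: eq_bigr => x _; rewrite inE; case: (P x).
Qed.

Lemma inl_injective (A B : Type) (x y : A) : @inl A B x = inl y -> x = y.
Proof. by case. Qed.


(** Chooses one point of each pair exchanged by the involution [p], so that unordered pairs are
    counted once. *)
Definition low (U : finType) (p : U -> U) (x : U) : bool := enum_rank x < enum_rank (p x).

Lemma card_low (U : finType) (p : U -> U) : involutive p ->
  2 * #|[set x | low p x]| + #|[set x | p x == x]| = #|U|.
Proof.
move=> pK; have -> : 2 * #|[set x | low p x]| = #|[set x | low p x]| + #|[set x | low p (p x)]|.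
  rewrite mul2n -addnn -[in X in _ = _ + X](card_imset _ (inv_inj pK)); congr (_ + _).
  apply: eq_card => x; apply/idP/imsetP; rewrite inE.
    by move=> h; exists (p x); rewrite ?inE pK.
  by case=> y; rewrite inE => h ->.
rewrite !card_set_sum -[in RHS]sum1_card -!big_split /=.
apply: eq_bigr => x _; rewrite /low pK.
by rewrite -(inj_eq enum_rank_inj) -val_eqE /=; case: ltngtP.
Qed.

Lemma lowP (U : finType) (p : U -> U) (x : U) : involutive p -> p x != x ->
  low p x || low p (p x).
Proof.
move=> pK; rewrite /low pK -(inj_eq enum_rank_inj) -val_eqE /=; lia.
Qed.

(** Perfect matchings as involutions without fixed points. As there are [#|U| - 1] of them, covering
    every pair forces each pair to have just one colour. *)
Definition one_fact (U C : finType) (p : C -> U -> U) : Prop :=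
  [/\ forall c, involutive (p c), forall c x, p c x != x,
      forall x y, x != y -> exists c, p c x = y & #|C|.+1 = #|U|].

Definition near_fact (U : finType) (r : U -> U -> U) : Prop :=
  [/\ forall c, involutive (r c), forall c x, (r c x == x) = (x == c) &
      forall x y, x != y -> exists c, r c x = y].

(** The [L s] are [#|W|] permutations of which exactly one takes [x] to [y]: a Latin square in the
    coordinates [s], [x], [y]. *)
Definition latin (W : finType) (L : W -> W -> W) : Prop :=
  (forall s, injective (L s)) /\ (forall x y, exists s, L s x = y).

Lemma one_fact_transport (U U' C : finType) (p : C -> U -> U) (f : U -> U') (g : U' -> U) :
  cancel f g -> cancel g f -> one_fact p -> one_fact (fun c x => f (p c (g x))).
Proof.
move=> fK gK [pK p0 pc Cn]; split=> [c x|c x|x y xy|].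
- by rewrite fK pK gK.
- by rewrite -{2}(gK x) (inj_eq (can_inj fK)).
- have [|c e] := pc (g x) (g y); first by rewrite (inj_eq (can_inj gK)).
  by exists c; rewrite e gK.
- by rewrite Cn; apply: bij_eq_card (Bijective fK gK).
Qed.

Section OrdZmod.
Variable q : nat.
Hypothesis qodd : odd q.+1.
Open Scope ring_scope.

Lemma dbl_inj : injective (fun x : 'I_q.+1 => x + x).
Proof.
move=> x y /eqP; rewrite -subr_eq0 opprD addrACA => /eqP h.
apply/eqP; rewrite -subr_eq0; move: (x - y) h => z /(congr1 val) /= h.
apply/eqP/val_inj => /=; have zq := ltn_ord z.
case: (ltnP (z + z) q.+1) => [lt|ge]; first by rewrite modn_small in h; lia.
have e : (z + z = q.+1 + (z + z - q.+1))%N by lia.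
by rewrite e modnDl modn_small in h; lia.
Qed.

Lemma half_ex (x : 'I_q.+1) : exists y, y + y = x.
Proof. by have [g _ gK] := injF_bij dbl_inj; exists (g x); rewrite gK. Qed.

Lemma near_fact_ord : near_fact (fun c x : 'I_q.+1 => c + c - x).
Proof.
split=> [c x|c x|x y xy].
- by rewrite opprB addrC subrK.
- rewrite subr_eq; apply/eqP/eqP=> [/esym/dbl_inj //|->//].
- by have [c cxy] := half_ex (x + y); exists c; rewrite cxy addrC addKr.
Qed.

(* Prolongation of the cyclic Latin square of order [q.+1] along the transversals
   [y - x = o j + o j]. *)
Section Prolong.
Variables (K : finType) (o : K -> 'I_q.+1) (L0 : K -> K -> K).
Hypotheses (oi : injective o) (o0 : forall j, o j != 0) (lL0 : latin L0).

Definition prolong (s x : 'I_q.+1 + K) : 'I_q.+1 + K :=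
  match s, x with
  | inr j, inl x => inl (x + o j + o j)
  | inr j, inr i => inr (L0 j i)
  | inl c, inr j => inl (c + o j)
  | inl c, inl x => if [pick j | x == c - o j] is Some j then inr j else inl (c + c - x)
  end.

Lemma prolong_latin : latin prolong.
Proof.
split=> [[c|j] [x|i] [x'|i'] //=|[x|i] [y|j]] /=.
- case: pickP => [j /eqP->|h]; case: pickP => [j' /eqP->|h'] //.
    by case=> ->.
  by move=> e; rewrite (oppr_inj (addrI _ (inl_injective e))).
- case: pickP => [j /eqP->|h] // e; have {}e := inl_injective e; have := h i'.
  have -> : x = c + c - (c + c - x) by rewrite subKr.
  by rewrite e opprD addrACA subrr add0r addrC eqxx.
- case: pickP => [j /eqP->|h] // e; have {}e := inl_injective e; have := h i.
  have -> : x' = c + c - (c + c - x') by rewrite subKr.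
  by rewrite -e opprD addrACA subrr add0r addrC eqxx.
- by move=> e; rewrite (oi (addrI _ (inl_injective e))).
- by move=> e; rewrite (addIr _ (addIr _ (inl_injective e))).
- by case=> /(lL0.1 j) ->.
- case: (pickP (fun j => y == x + o j + o j)) => [j /eqP->|h]; first by exists (inr j).
  have [c cxy] := half_ex (x + y); exists (inl c) => /=.
  (* If [x = c - o j], then [y = c + o j = x + o j + o j], the case excluded by [h]. *)
  case: pickP => [j /eqP xe|_]; last by rewrite cxy addrC addKr.
  have cx : x + o j = c by rewrite xe subrK.
  by have /eqP[] := h j; apply: (addrI x); rewrite cx -cxy addrCA cx.
- exists (inl (x + o j)) => /=; case: pickP => [j' /eqP|/(_ j)]; last by rewrite addrK eqxx.
  by rewrite -addrA -{1}[x]addr0 => /addrI/esym/eqP; rewrite subr_eq0 => /eqP/oi->.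
- by exists (inl (y - o i)); rewrite /= subrK.
- by have [s <-] := lL0.2 i j; exists (inr s).
Qed.

Lemma prolong_idem c : prolong (inl c) (inl c) = inl c.
Proof.
rewrite /=; case: pickP => [j|_]; last by rewrite addrK.
by rewrite -{1}[c]addr0 (inj_eq (addrI c)) eq_sym oppr_eq0 (negbTE (o0 j)).
Qed.
End Prolong.
End OrdZmod.

Lemma near_fact_odd (W : finType) : odd #|W| -> exists r : W -> W -> W, near_fact r.
Proof.
case e : #|W| => [//|q] qo; have [|f [g fK gK]] := @card_bij W 'I_q.+1; first by rewrite card_ord.
pose r := fun c x : 'I_q.+1 => (c + c - x)%R.
have [rK r0 rc] : near_fact r := near_fact_ord qo.
exists (fun c x => g (r (f c) (f x))); split=> [c x|c x|x y xy].
- by rewrite gK rK fK.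
- by rewrite -{2}(fK x) (inj_eq (can_inj gK)) r0 (inj_eq (can_inj fK)).
- have [|c cxy] := rc (f x) (f y); first by rewrite (inj_eq (can_inj fK)).
  by exists (g c); rewrite gK cxy fK.
Qed.

Lemma latin_ord n : exists L : 'I_n -> 'I_n -> 'I_n, latin L.
Proof.
case: n => [|n]; first by exists (fun _ x => x); split=> [[]|[]].
exists (fun s x => (s + x)%R); split=> [s|x y]; first exact: addrI.
by exists (y - x)%R; rewrite subrK.
Qed.

(* The matchings [p c] that map one point of [s] into [t] map all of [s] onto [t]: on
   [s] x [t] the one-factorization is a Latin square on #|K| colours. *)
Definition factK (U C K : finType) (p : C -> U -> U) (s t : K -> U) (o : U) : Prop :=
  [/\ one_fact p, injective s, injective t, forall x y, s x != t y &
     (forall x, (s x != o) && (t x != o)) /\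
     (forall c x y, p c (s x) = t y -> forall z, exists w, p c (s z) = t w)].

Definition fact (m k : nat) : Prop :=
  exists (C : finType) (p : C -> 'I_m -> 'I_m) (s t : 'I_k -> 'I_m) o, factK p s t o.

Lemma factK_fact (U C K : finType) (p : C -> U -> U) (s t : K -> U) o :
  factK p s t o -> fact #|U| #|K|.
Proof.
case=> pf si ti st [so cl].
exists C, (fun c x => enum_rank (p c (enum_val x))), (fun x => enum_rank (s (enum_val x))),
  (fun x => enum_rank (t (enum_val x))), (enum_rank o); split.
- exact: one_fact_transport (@enum_rankK _) (@enum_valK _) pf.
- by move=> x y /enum_rank_inj/si/enum_val_inj.
- by move=> x y /enum_rank_inj/ti/enum_val_inj.
- by move=> x y; rewrite (inj_eq enum_rank_inj).
split=> [x|c x y]; first by rewrite !(inj_eq enum_rank_inj).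
rewrite !enum_rankK => /enum_rank_inj/cl h z; have [w e] := h (enum_val z).
by exists (enum_rank w); rewrite !enum_rankK e.
Qed.

(** Each matching is lifted to two on pairs by adding a bit [b] to the second coordinate, and [None]
    swaps the two copies. Adding a bit does not disturb the closure of [s] and [t]. *)
Lemma fact_double m k : fact m k -> fact (2 * m) (2 * k).
Proof.
case=> C [p [s [t [o [[pK p0 pc Cn] si ti st [so cl]]]]]].
pose p' (c : option (C * bool)) (x : 'I_m * bool) :=
  if c is Some (c, b) then (p c x.1, b (+) x.2) else (x.1, ~~ x.2).
have <- : #|{: 'I_m * bool}| = 2 * m by rewrite card_prod card_ord card_bool mulnC.
have <- : #|{: 'I_k * bool}| = 2 * k by rewrite card_prod card_ord card_bool mulnC.
apply: (@factK_fact _ _ _ p' (fun x => (s x.1, x.2)) (fun x => (t x.1, x.2)) (o, true)).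
split; first split.
- by case=> [[c b]|] [x i] /=; rewrite /p' /= ?pK ?negbK // addKb.
- case=> [[c b]|] [x i]; rewrite /p' xpair_eqE /= ?(negbTE (p0 _ _)) //.
  by rewrite eqxx; case: i.
- move=> [x i] [y j]; rewrite xpair_eqE; case: (x =P y) => /= [<-|/eqP/pc[c <-] _].
    by move=> ij; exists None; rewrite /p' /=; case: i j ij => [] [].
  by exists (Some (c, i (+) j)); rewrite /p' /= -addbA addbC -addbA addbb addbF.
- rewrite card_option !card_prod card_ord card_bool.
  by rewrite -(card_ord m) -Cn; lia.
- by move=> [x i] [y j] [/si-> ->].
- by move=> [x i] [y j] [/ti-> ->].
- by move=> [x i] [y j]; rewrite xpair_eqE (negbTE (st _ _)).
split=> [[x i]|[[c b]|] [x i] [y j]]; rewrite /p' /=.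
- by rewrite !xpair_eqE; have /andP[/negbTE-> /negbTE->] := so x.
- case=> /cl h _ [z l]; have [w e] := h z; exists (w, b (+) l); rewrite /= e //.
- by case=> /eqP; rewrite (negbTE (st _ _)).
Qed.

Lemma fact1 m : 2 < m -> (exists (C : finType) (p : C -> 'I_m -> 'I_m), one_fact p) -> fact m 1.
Proof.
case: m => [//|[//|[//|m]]] _ [C [p pf]].
exists C, p, (fun=> ord0), (fun=> lift ord0 ord0), ord_max; split=> //.
- by move=> x y _; rewrite !ord1.
- by move=> x y _; rewrite !ord1.
Qed.

(** Two copies of a set [W] of odd order. Colours [inl c] join a near-factor of each copy by the
    edge between the two missed points; the others are rows of a Latin square on [W]. That square is
    a cyclic one prolonged by [k] points, so it has a subsquare of side [k], which gives the sets
    [s] and [t]. *)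
Lemma fact_2odd q k : odd q.+1 -> k <= q -> ~~ odd k -> fact (2 * (q.+1 + k)) k.
Proof.
move=> qo kq ke; have [L0 lL0] := latin_ord k.
have oI : injective (fun j : 'I_k => inord j.+1 : 'I_q.+1).
  move=> i j /(congr1 val) /=; have := ltn_ord i; have := ltn_ord j => ? ?.
  by rewrite !inordK; try lia; case=> /val_inj.
have o0 (j : 'I_k) : (inord j.+1 : 'I_q.+1) != 0%R.
  by rewrite -val_eqE /= inordK //; have := ltn_ord j; lia.
pose W : finType := ('I_q.+1 + 'I_k)%type; have Wo : #|W| = q.+1 + k by rewrite card_sum !card_ord.
have [Li Lc] := prolong_latin qo oI lL0; set L := prolong _ _ in Li Lc.
have [|r [rK r0 rc]] := @near_fact_odd W; first by rewrite Wo oddD qo (negbTE ke).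
(* Composing with the inverse of row [a0] makes that row the identity; its edges are the ones
   joining the points missed by the near-factors, so [a0] is dropped from the colours. *)
pose a0 : W := inl 0%R; pose iL s := invF (Li s).
pose M s x := iL a0 (L s x); pose iM s x := iL s (L a0 x).
have LK s : cancel (L s) (iL s) := invF_f (Li s).
have iLK s : cancel (iL s) (L s) := f_invF (Li s).
have MK s x : iM s (M s x) = x by rewrite /iM /M iLK LK.
have iMK s x : M s (iM s x) = x by rewrite /iM /M iLK LK.
pose p (c : W + {s : W | s != a0}) (x : bool * W) : bool * W :=
  match c with
  | inl c => if x.2 == c then (~~ x.1, c) else (x.1, r c x.2)
  | inr s => if x.1 then (false, iM (val s) x.2) else (true, M (val s) x.2)
  end.
have <- : #|{: bool * W}| = 2 * (q.+1 + k) by rewrite card_prod card_bool Wo.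
rewrite -[k in fact _ k]card_ord.
apply: (@factK_fact _ _ _ p (fun i => (false, inr i)) (fun i => (true, iL a0 (inr i))) (true, iL a0 (inl 0%R))).
have rc1 c : r c c = c by apply/eqP; rewrite r0.
have cross x y : exists c, p c (false, x) = (true, y).
  have [s e] := Lc x (L a0 y); case: (altP (s =P a0)) => [sa|sa].
    by exists (inl x); rewrite /p /= eqxx; rewrite sa in e; rewrite (Li _ _ _ e).
  by exists (inr (exist _ s sa)); rewrite /p /= /M e LK.
have pK c : involutive (p c).
  case: c => [c|s] [b x]; rewrite /p /=; last by case: b; rewrite /= ?MK ?iMK.
  case: (x =P c) => [->|/eqP xc] /=; first by rewrite eqxx negbK.
  by rewrite -{2}(rc1 c) (inj_eq (inv_inj (rK c))) (negbTE xc) rK.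
split; first split=> //.
- case=> [c|s] [b x]; rewrite /p /=; last by case: b.
  by case: (x =P c) => [->|/eqP xc]; rewrite xpair_eqE /= ?r0 ?(negbTE xc) ?andbF //; case: b.
- move=> [[] x] [[] y] xy.
  + have [|c cxy] := rc x y; first by apply: contraNneq xy => ->.
    exists (inl c); rewrite /p /= cxy; case: (x =P c) => // xc.
    by move: xy cxy; rewrite xc rc1 => h e; rewrite e eqxx in h.
  + by have [c e] := cross y x; exists c; rewrite -e pK.
  + exact: cross.
  + have [|c cxy] := rc x y; first by apply: contraNneq xy => ->.
    exists (inl c); rewrite /p /= cxy; case: (x =P c) => // xc.
    by move: xy cxy; rewrite xc rc1 => h e; rewrite e eqxx in h.
- rewrite card_sum card_prod card_bool card_sig.
  have := cardC1 a0; rewrite (eq_card (B := predC1 a0)) // => ->.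
  by rewrite Wo; lia.
- by move=> i j [].
- by move=> i j [] /(can_inj (iLK a0)) [].
- by [].
split=> [x|c x y]; first by rewrite !xpair_eqE (inj_eq (can_inj (iLK a0))).
(* An [inl] colour would require row [a0] to send an adjoined point to an adjoined point, but it
   sends all of them into the cyclic part. Otherwise [L s] takes an adjoined point to an adjoined
   one only if [s] is itself adjoined, and then it does so for all of them. *)
case: c => [c|[s sa]]; rewrite /p /=.
  case: ifP => // /eqP <- [] /(congr1 (L a0)); rewrite iLK //.
case=> /(can_inj (iLK a0)); case: s sa => [c|j] sa //= e z.
  by exists (L0 j z).
Qed.

Lemma fact_even m : ~~ odd m -> 4 <= m -> exists a, m <= 16 * 2 ^ a /\ fact m (2 ^ a).
Proof.
elim/ltn_ind: m => m IH me m4.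
have [m' em] : exists m', m = 2 * m' by exists m./2; have := odd_double_half m; lia.
case: (boolP (odd m')) => mo.
  case: (ltnP m' 5) => m5.
    have {}em : m = 6 by case: m' em m5 mo => [|[|[|[|[|]]]]] //; lia.
    subst m; exists 0; split=> //; apply: fact1 => //.
    by have [C [p [s [t [o [pf]]]]]] := @fact_2odd 2 0 isT isT isT; exists C, p.
  (* The largest power of two with [2 ^ a <= q] when [m'] is split as [q.+1 + 2 ^ a]. For [m' >= 5]
     it is even, which keeps [q.+1] odd. *)
  pose a := trunc_log 2 (m'.-1)./2; exists a.
  have h : 0 < (m'.-1)./2 by lia.
  have /andP[a1 a2] := trunc_log_bounds (isT : 1 < 2) h; rewrite -/a in a1 a2.
  have a0 : 0 < a by rewrite /a; apply: trunc_log_max => //; lia.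
  rewrite expnS in a2; split; first by lia.
  have ko : ~~ odd (2 ^ a) by rewrite oddX negb_or; lia.
  have -> : m = 2 * ((m' - 2 ^ a).-1.+1 + 2 ^ a) by rewrite em; lia.
  apply: fact_2odd => //; last by lia.
  rewrite prednK; last by lia.
  by rewrite oddB; [rewrite mo (negbTE ko)|lia].
case: (ltnP m' 4) => m4'.
  have {}em : m = 2 * 2 by case: m' em m4' mo m4 => [|[|[|[|]]]] //; lia.
  exists 0; split; first by rewrite em.
  subst m; apply: fact1 => //.
  pose p (c : option bool) (x : bool * bool) : bool * bool :=
    if c is Some b then (~~ x.1, b (+) x.2) else (x.1, ~~ x.2).
  have pf : one_fact p.
    split; [by case=> [[]|] [[] []]|by case=> [[]|] [[] []]| |].
      move=> [i j] [i' j'] ij; exists (if i == i' then None else Some (j (+) j')).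
      by move: ij; case: i; case: i'; case: j; case: j'.
    by rewrite card_option card_prod card_bool.
  have [f [g fK gK]] : exists f : bool * bool -> 'I_(2 * 2), bijective f.
    by apply: card_bij; rewrite card_prod card_bool card_ord.
  by exists (option bool), (fun c x => f (p c (g x))); apply: one_fact_transport fK gK pf.
have [|a [a1 a2]] := IH m' _ mo m4'; first by lia.
exists a.+1; rewrite expnS em; split; first by lia.
exact: fact_double.
Qed.

Lemma one_fact_ex (U : finType) : ~~ odd #|U| -> 1 < #|U| ->
  exists (C : finType) (p : C -> U -> U), one_fact p.
Proof.
move=> Ue U1; suff [C [p pf]] : exists (C : finType) (p : C -> 'I_#|U| -> 'I_#|U|), one_fact p.
  by exists C, (fun c x => enum_val (p c (enum_rank x)));
     apply: one_fact_transport pf; [exact: enum_valK|exact: enum_rankK].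
case: (ltnP 2 #|U|) => U2.
  have [|a [_ [C [p [s [t [o [pf]]]]]]]] := fact_even Ue; last by exists C, p.
  by case: #|U| Ue U1 U2 => [|[|[|[|]]]].
have -> : #|U| = 2 by lia.
exists unit, (fun _ x => rev_ord x); split=> [_|_ x|x y xy|].
- exact: rev_ordK.
- by case: x => [[|[|]]].
- by exists tt; move: xy; case: x => [[|[|]]] // ?; case: y => [[|[|]]] // ? _; apply/val_inj.
- by rewrite card_unit card_ord.
Qed.

(** Prolonging a cyclic square of odd order by one point along an off-diagonal transversal leaves
    its idempotent diagonal alone, and the added point is idempotent too. *)
Lemma idem_latin (W : finType) : ~~ odd #|W| -> 4 <= #|W| ->
  exists L : W -> W -> W, latin L /\ forall s, L s s = s.
Proof.
move=> We W4; case e : #|W| We W4 => [//|[//|q]] qe q2.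
have qo : odd q.+1 by lia.
pose o (_ : unit) : 'I_q.+1 := inord 1.
have oI : injective o by case=> - [].
have o0 j : o j != 0%R by rewrite /o -val_eqE /= inordK //; lia.
have lL0 : latin (fun _ x : unit => x).
  by split=> [s x y|x y]; [|exists tt; case: x; case: y].
have [f [g fK gK]] : exists f : W -> ('I_q.+1 + unit), bijective f.
  by apply: card_bij; rewrite card_sum card_ord card_unit e addn1.
have [Li Lc] := prolong_latin qo oI lL0.
exists (fun s x => g (prolong o (fun _ x => x) (f s) (f x))); split; first split.
- by move=> s x y /(can_inj gK)/(Li _ _ _)/(can_inj fK).
- by move=> x y; have [s h] := Lc (f x) (f y); exists (g s); rewrite gK h fK.
- move=> s; apply: (can_inj fK); rewrite gK; case: (f s) => [c|[]] //.
  exact: prolong_idem.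
Qed.

(* The factors [P (c, false)] miss exactly the points [(c, _)]; the factors [P (c, true)]
   are perfect. *)
Definition mixed_fact (K : finType) (P : K * bool -> K * bool -> K * bool) : Prop :=
  [/\ forall s, involutive (P s), forall s x, (P s x == x) = ~~ s.2 && (x.1 == s.1) &
      forall x y, x != y -> exists s, P s x = y].

(** Inside the two copies the reflections in [c] are near-factors missing [c]; between the copies
    the translations by [c] are perfect. *)
Lemma mixed_fact_odd q : odd q.+1 ->
  exists P : 'I_q.+1 * bool -> 'I_q.+1 * bool -> 'I_q.+1 * bool, mixed_fact P.
Proof.
move=> qo; have [rK r0 rc] := near_fact_ord qo.
pose P (s x : 'I_q.+1 * bool) :=
  if s.2 then ((if x.2 then x.1 - s.1 else x.1 + s.1)%R, ~~ x.2) else ((s.1 + s.1 - x.1)%R, x.2).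
exists P; split=> [[c []] [x i]|[c []] [x i]|[x i] [y j]]; rewrite /P /= ?xpair_eqE.
- by case: i; rewrite /= ?subrK ?addrK.
- by rewrite (rK c x).
- by case: i; rewrite andbF.
- by rewrite r0 eqxx andbT.
- case: (i =P j) => [->|/eqP ij xy].
    by rewrite andbT => /rc[c <-]; exists (c, false).
  case: i ij xy; case: j => // _ _; first by exists ((x - y)%R, true); rewrite /= subKr.
  by exists ((y - x)%R, true); rewrite /= addrC subrK.
Qed.

(** The roles are exchanged with respect to odd order: an idempotent square gives the factors
    between the copies, row [c] omitting the edge over [c]. The perfect factors are a
    one-factorization of both copies, with one more factor made of all these omitted edges. *)
Lemma mixed_fact_even (K : finType) : ~~ odd #|K| -> 4 <= #|K| ->
  exists P : K * bool -> K * bool -> K * bool, mixed_fact P.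
Proof.
move=> Ke K4; have [L [[Li Lc] Ls]] := idem_latin Ke K4.
have [|C [p [pK p0 pc Cn]]] := one_fact_ex Ke; first by lia.
have [g [g' gK g'K]] : exists g : K -> option C, bijective g.
  by apply: card_bij; rewrite card_option.
pose iL s := invF (Li s).
have LK s : cancel (L s) (iL s) := invF_f (Li s).
have iLK s : cancel (iL s) (L s) := f_invF (Li s).
have iLs s : iL s s = s by rewrite -{2}(Ls s) LK.
pose P (s x : K * bool) :=
  if s.2 then (if g s.1 is Some a then (p a x.1, x.2) else (x.1, ~~ x.2)) else
  if x.1 == s.1 then x else if x.2 then (iL s.1 x.1, false) else (L s.1 x.1, true).
exists P; split=> [[c []] [x i]|[c []] [x i]|[x i] [y j]]; rewrite /P /=.
- by case: (g c) => [a|] /=; rewrite ?pK ?negbK.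
- case: (x =P c) => [->|/eqP xc] /=; first by rewrite eqxx.
  case: i => /=.
    by rewrite -{2}(iLs c) (inj_eq (can_inj (iLK c))) (negbTE xc) iLK.
  by rewrite -{2}(Ls c) (inj_eq (Li c)) (negbTE xc) LK.
- case: (g c) => [a|] /=; rewrite xpair_eqE ?(negbTE (p0 _ _)) //= eqxx.
  by case: i.
- by case: (x =P c) => [->|/eqP xc]; rewrite ?eqxx //; case: i; rewrite xpair_eqE andbF.
- rewrite xpair_eqE; case: (i =P j) => [->|/eqP ij _].
    rewrite andbT => /pc[a <-]; exists (g' (Some a), true).
    by rewrite /= g'K.
  case: (x =P y) => [<-|/eqP xy].
    by exists (g' None, true); rewrite /= g'K; case: i j ij => [] [].
  have cr x' y' : x' != y' -> exists s, [/\ x' != s, y' != s & L s x' = y'].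
    move=> xy'; have [s h] := Lc x' y'; exists s; split=> //.
      by apply: contraNneq xy' => xs; rewrite -h -xs Ls.
    by apply: contraNneq xy' => ys; rewrite -(Li s x' y') // h ys Ls.
  case: i ij; case: j => // _.
    have [|s [_ xs h]] := cr y x; first by rewrite eq_sym.
    by exists (s, false); rewrite /= (negbTE xs) -h LK.
  have [s [xs _ h]] := cr x y xy; exists (s, false).
  by rewrite /= (negbTE xs) h.
Qed.

(** * Order 2u *)

Definition four (T K : Type) (f0 f1 f2 f3 : K -> T) (p : 'I_4 * K) : T :=
  match val p.1 with 0 => f0 p.2 | 1 => f1 p.2 | 2 => f2 p.2 | _ => f3 p.2 end.

Lemma four_flex (T I K : finType) (v : I -> {set T}) (f0 f1 f2 f3 : K -> T) (o : T) n k :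
  design v -> #|T| = n -> #|K| = k ->
  [/\ injective f0, injective f1, injective f2 & injective f3] ->
  (forall x y, [&& f0 x != f1 y, f0 x != f2 y, f0 x != f3 y, f1 x != f2 y, f1 x != f3 y & f2 x != f3 y]) ->
  (forall x, [&& f0 x != o, f1 x != o, f2 x != o & f3 x != o]) ->
  (forall x y z, exists w i, v i = quad (f0 x) (f1 y) (f2 z) (f3 w)) ->
  flex n k.
Proof.
move=> dv Tn Kk [i0 i1 i2 i3] fd fo fv.
apply: (design_flex (f := four f0 f1 f2 f3) (o := o) dv Tn Kk).
- move=> [[i il] x] [[j jl] y]; rewrite /four /=.
  have /and5P[/eqP d01 /eqP d02 /eqP d03 /eqP d12 /andP[/eqP d13 /eqP d23]] := fd x y.
  have /and5P[/eqP e01 /eqP e02 /eqP e03 /eqP e12 /andP[/eqP e13 /eqP e23]] := fd y x.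
  case: i il => [|[|[|[|//]]]] il; case: j jl => [|[|[|[|//]]]] jl //= e; try congruence;
    rewrite (bool_irrelevance il jl).
  + by rewrite (i0 _ _ e).
  + by rewrite (i1 _ _ e).
  + by rewrite (i2 _ _ e).
  + by rewrite (i3 _ _ e).
- move=> [[i il] x]; rewrite /four /=; have /and4P[? ? ? ?] := fo x.
  by case: i il => [|[|[|[|]]]].
- move=> x y z; have [w [i vi]] := fv x y z; exists w, i.
  by rewrite vi /four /= !inordK.
Qed.

Section Squares.
Variables (U C : finType) (p : C -> U -> U).

(** Two pairs of the same colour, one in each copy, each given by its [low] point. *)
Definition sq_index := {t : C * U * U | low (p t.1.1) t.1.2 && low (p t.1.1) t.2}.

Definition sq_block (T : finType) (f g : U -> T) (t : C * U * U) : {set T} :=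
  quad (f t.1.2) (f (p t.1.1 t.1.2)) (g t.2) (g (p t.1.1 t.2)).

Hypotheses (pK : forall c, involutive (p c)) (p0 : forall c x, p c x != x).

Lemma sq_card : 4 * #|{: sq_index}| = #|C| * #|U| * #|U|.
Proof.
have hc c : 2 * #|[set x | low (p c) x]| = #|U|.
  rewrite -(card_low (pK c)) [X in _ = _ + X](_ : _ = 0) ?addn0 //.
  by apply/eqP; rewrite cards_eq0; apply/eqP/setP=> x; rewrite !inE (negbTE (p0 c x)).
rewrite card_sig (eq_card (B := [set t | low (p t.1.1) t.1.2 && low (p t.1.1) t.2])); last first.
  by move=> t; rewrite !inE.
rewrite card_set_sum.
pose F c x y : nat := low (p c) x && low (p c) y.
rewrite (eq_bigr (fun t : C * U * U => F t.1.1 t.1.2 t.2)) //.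
rewrite -(pair_bigA _ (fun a y => F a.1 a.2 y)) /= -(pair_bigA _ (fun c x => \sum_y F c x y)) /=.
rewrite big_distrr /= -mulnA -sum_nat_const; apply: eq_bigr => c _.
rewrite -(hc c) card_set_sum.
have -> : \sum_x \sum_y F c x y = (\sum_x low (p c) x) * (\sum_x low (p c) x).
  rewrite big_distrl /=; apply: eq_bigr => x _; rewrite big_distrr /=.
  by apply: eq_bigr => y _; rewrite mulnb.
lia.
Qed.

Lemma sq_rep c x y : exists i : sq_index, forall (T : finType) (f g : U -> T),
  sq_block f g (val i) = quad (f x) (f (p c x)) (g y) (g (p c y)).
Proof.
have sw (T : finType) (a b c' d : T) : quad b a c' d = quad a b c' d.
  by rewrite /quad [[set b; a]]setUC.
have sw' (T : finType) (a b c' d : T) : quad a b d c' = quad a b c' d.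
  by rewrite /quad -!setUA [[set d; c']]setUC.
case/orP: (lowP (pK c) (p0 c x)) => hx; case/orP: (lowP (pK c) (p0 c y)) => hy.
- have h : low (p c) x && low (p c) y by rewrite hx.
  by exists (exist _ (c, x, y) h).
- have h : low (p c) x && low (p c) (p c y) by rewrite hx.
  by exists (exist _ (c, x, p c y) h) => T f g; rewrite /sq_block /= pK sw'.
- have h : low (p c) (p c x) && low (p c) y by rewrite hx.
  by exists (exist _ (c, p c x, y) h) => T f g; rewrite /sq_block /= pK sw.
- have h : low (p c) (p c x) && low (p c) (p c y) by rewrite hx.
  by exists (exist _ (c, p c x, p c y) h) => T f g; rewrite /sq_block /= !pK sw sw'.
Qed.
End Squares.

Lemma in_quad (T : finType) (x y z w t : T) :
  (t \in quad x y z w) = [|| t == x, t == y, t == z | t == w].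
Proof. by rewrite /quad !inE -!orbA. Qed.

Section Doubling.
Variables (U I C : finType) (v : I -> {set U}) (p : C -> U -> U).
Hypotheses (dv : design v) (In : 24 * #|I| = #|U| * #|U|.-1 * #|U|.-2) (pf : one_fact p).

Definition dbl_block (i : bool * I + sq_index p) : {set bool * U} :=
  match i with
  | inl (b, i) => pair b @: v i
  | inr t => sq_block p (pair false) (pair true) (val t)
  end.

Lemma dbl_design : design dbl_block.
Proof.
have [v4 vc _] := dv; have [pK p0 pc Cn] := pf.
have pI b : injective (pair b : U -> bool * U) by move=> x y [].
split=> [[[b i]|t]||].
- by rewrite /dbl_block card_imset.
- exact: card_quad_le.
- have pr b x y z : x != y -> exists i, [&& (b, x) \in dbl_block i, (b, y) \in dbl_block i & (~~ b, z) \in dbl_block i].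
    move=> /pc[c <-]; case: b.
      have [i e] := sq_rep pK p0 c z x; exists (inr i).
      by rewrite /dbl_block e !in_quad !eqxx ?orbT.
    have [i e] := sq_rep pK p0 c x z; exists (inr i).
    by rewrite /dbl_block e !in_quad !eqxx ?orbT.
  apply: (@covers_sorted _ _ _ (fun t => nat_of_bool t.1)) => -[a x] [b y] [c z].
  rewrite !xpair_eqE /=.
  case: a; case: b; case: c; rewrite //= => xy xz yz _.
  + have [i /and3P[h1 h2 h3]] := vc x y z xy xz yz.
    by exists (inl (true, i)); rewrite /dbl_block !imset_f.
  + have [i /and3P[h1 h2 h3]] := pr true y z x yz.
    by exists i; rewrite h1 h2 h3.
  + exact: (pr false).
  + have [i /and3P[h1 h2 h3]] := vc x y z xy xz yz.
    by exists (inl (false, i)); rewrite /dbl_block !imset_f.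
- rewrite card_sum !card_prod card_bool; have := sq_card pK p0; rewrite -/(sq_index p).
  move: In; rewrite -Cn; move: #|I| #|C| #|{: sq_index p}| => a b c /=.
  nia.
Qed.
End Doubling.

Lemma sqs_double n : sqs n -> ~~ odd n -> 1 < n -> sqs (2 * n).
Proof.
move=> sn en n1; have [I [v [dv In _]]] := sqs_design sn.
have [||C [p pf]] := @one_fact_ex 'I_n; rewrite ?card_ord //.
apply: (design_sqs (dbl_design dv _ pf)); rewrite ?card_ord //.
by rewrite card_prod card_bool card_ord.
Qed.

(** The four sets are [s] and [t] in either copy. The colour of the pair [s x], [t y] maps all of
    [s] into [t], so the square through [s z] ends in [t]. *)
Lemma flex_double n k : sqs n -> fact n k -> flex (2 * n) k.
Proof.
move=> sn [C [p [s [t [o [pf si ti st [so cl]]]]]]]; have [I [v [dv In _]]] := sqs_design sn.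
have [pK p0 pc Cn] := pf.
apply: (@four_flex _ _ _ _ (fun x => (false, s x)) (fun x => (false, t x))
  (fun x => (true, s x)) (fun x => (true, t x)) (false, o) _ _ (dbl_design dv _ pf));
  rewrite ?card_ord //.
- by rewrite card_prod card_bool card_ord.
- by split=> x y [] => [/si|/ti|/si|/ti].
- by move=> x y; rewrite !xpair_eqE /= !(negbTE (st _ _)).
- by move=> x; rewrite !xpair_eqE /=; have /andP[-> ->] := so x.
- move=> x y z; have [c e] := pc _ _ (st x y); have [w e'] := cl _ _ _ e z.
  have [i h] := sq_rep pK p0 c (s x) (s z).
  by exists w, (inr i); rewrite /dbl_block h e e'.
Qed.

(** * Order 4u - 6 *)

Section Quadrupling.
Variables (k : nat) (I C : finType).
Notation V := ('I_k.+1 * bool)%type.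
Notation T := (bool + bool * bool * V)%type.
Variables (P : V -> V -> V) (F : C -> V -> V) (v : I -> {set bool + V}).
Hypotheses (mP : mixed_fact P) (fF : one_fact F) (dv : design v).
Hypothesis In : 24 * #|I| = #|{: bool + V}| * #|{: bool + V}|.-1 * #|{: bool + V}|.-2.

(** The group law of Z_(k+1) x Z_2, which colours the pairs across the two groups of a half by a
    Latin square. *)
Definition qcol (x y : V) : V := ((x.1 + y.1)%R, x.2 (+) y.2).
Definition qshift (s : V) (e : bool) : V := (s.1, s.2 (+) e).
Definition qpt (h i : bool) (x : V) : T := inr (h, i, x).
Definition qin (h i : bool) (x : bool + V) : T :=
  match x with inl l => inl l | inr x => qpt h i x end.

Definition qlow (t : (V * V) * (bool * V)) : bool :=
  low (P (qshift (qcol t.1.1 t.1.2) t.2.1)) t.2.2.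

Definition qpair_index := {t | qlow t}.

Definition quadr_index := (bool * bool * I + bool * V * V * bool + bool * qpair_index + bool * sq_index F)%type.

(* The factor [P] used on group [(~~ h, j)] by a pair of colour [s] across the two groups of
   half [h] is [qshift s j]; its two missed points, if any, go with the two infinite points. *)
Definition quadr_block (i : quadr_index) : {set T} :=
  match i with
  | inl (inl (inl (h, i, b))) => qin h i @: v b
  | inl (inl (inr (h, x, y, b))) =>
      quad (inl (h (+) x.2 (+) b)) (qpt h false x) (qpt h true y)
           (qpt (~~ h) (qcol x y).2 ((qcol x y).1, b))
  | inl (inr (h, t)) =>
      let: (x, y) := (val t).1 in let: (j, z) := (val t).2 in
      quad (qpt h false x) (qpt h true y) (qpt (~~ h) j z) (qpt (~~ h) j (P (qshift (qcol x y) j) z))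
  | inr (h, t) => sq_block F (qpt h false) (qpt h true) (val t)
  end.

Let PK := let: And3 a _ _ := mP in a.
Let P0 := let: And3 _ a _ := mP in a.
Let Pc := let: And3 _ _ a := mP in a.

Definition cov (x y z : T) := exists i, [&& x \in quadr_block i, y \in quadr_block i & z \in quadr_block i].

Lemma cov_perm1 x y z : cov x y z -> cov y x z.
Proof. by case=> i /and3P[a b c]; exists i; rewrite a b c. Qed.

Lemma cov_perm2 x y z : cov x y z -> cov x z y.
Proof. by case=> i /and3P[a b c]; exists i; rewrite a b c. Qed.

Lemma card_V : #|{: V}| = 2 * k.+1.
Proof. by rewrite card_prod card_ord card_bool mulnC. Qed.

Lemma card_missed (s : V) : #|[set x | P s x == x]| = (~~ s.2) * 2.
Proof.
case: (boolP s.2) => se.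
  by apply/eqP; rewrite cards_eq0; apply/eqP/setP=> x; rewrite !inE P0 se.
have -> : [set x | P s x == x] = [set (s.1, true); (s.1, false)].
  by apply/setP=> -[x i]; rewrite !inE P0 se !xpair_eqE /=; case: i; case: (x == s.1).
by rewrite cards2 xpair_eqE andbF.
Qed.

(** For each of the [#|V| ^ 2] cross pairs, one of the two factors used is perfect and the other
    misses two points, which makes [#|V| - 1] edges together. *)
Lemma card_qpair : #|{: qpair_index}| = (2 * k.+1) * (2 * k.+1) * (2 * k.+1).-1.
Proof.
rewrite card_sig (eq_card (B := [set t | qlow t])); last first.
  by move=> t; rewrite !inE.
rewrite card_set_sum.
pose G (a : V * V) (b : bool * V) : nat := low (P (qshift (qcol a.1 a.2) b.1)) b.2.
rewrite (eq_bigr (fun t : (V * V) * (bool * V) => G t.1 t.2)) //.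
rewrite -(pair_bigA _ G) /= (eq_bigr (fun=> (2 * k.+1).-1)); last first.
  move=> a _; rewrite -(pair_bigA _ (fun j z => G a (j, z))) /= big_bool /= /G /=.
  have h j := card_low (PK (qshift (qcol a.1 a.2) j)).
  have := h true; have := h false; rewrite !card_missed !card_set_sum card_V /=.
  by case: ((qcol a.1 a.2).2) => /=; lia.
by rewrite sum_nat_const card_prod card_V.
Qed.

Lemma cov_group h i (x y z : bool + V) : x != y -> x != z -> y != z ->
  cov (qin h i x) (qin h i y) (qin h i z).
Proof.
have [_ vc _] := dv => xy xz yz; have [b /and3P[bx by' bz]] := vc _ _ _ xy xz yz.
by exists (inl (inl (inl (h, i, b)))); rewrite /quadr_block !imset_f.
Qed.

Lemma cov_inf2 l h x y : cov (inl l) (qpt h false x) (qpt h true y).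
Proof.
exists (inl (inl (inr (h, x, y, l (+) h (+) x.2)))).
have e : h (+) x.2 (+) (l (+) h (+) x.2) = l by case: h; case: l; case: (x.2).
by rewrite /quadr_block !in_quad e !eqxx ?orbT.
Qed.

Lemma cov_inf_half l h i j x z : l = h (+) i && j (+) x.2 (+) z.2 ->
  cov (inl l) (qpt h i x) (qpt (~~ h) j z).
Proof.
pose y : V := ((z.1 - x.1)%R, j (+) x.2).
have e1 : qcol x y = (z.1, j) by rewrite /qcol /y /= addrC subrK addbC addbK.
have e2 : qcol y x = (z.1, j) by rewrite /qcol /y /= subrK addbK.
case: i => /= le.
  exists (inl (inl (inr (h, y, x, z.2)))); rewrite /quadr_block !in_quad e2 /=.
  rewrite -surjective_pairing !eqxx ?orbT !andbT {}le /=.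
  by case: h; case: j {y e1 e2}; case: (x.2); case: (z.2).
exists (inl (inl (inr (h, x, y, z.2)))); rewrite /quadr_block !in_quad e1 /=.
rewrite -surjective_pairing !eqxx ?orbT !andbT {}le /=.
by case: h; case: (x.2); case: (z.2).
Qed.

(** Blocks with their pair in the first half and blocks with their pair in the second half yield
    complementary values of [l]; this is why [h] enters the infinite point of [quadr_block]. *)
Lemma cov_inf l i j x z : cov (inl l) (qpt false i x) (qpt true j z).
Proof.
case: (altP (l =P false (+) i && j (+) x.2 (+) z.2)) => [|ln]; first exact: cov_inf_half.
apply: cov_perm2; apply: (@cov_inf_half l true); move: ln.
by case: l; case: i; case: j; case: (x.2); case: (z.2).
Qed.

Lemma cov_across h x y j z : cov (qpt h false x) (qpt h true y) (qpt (~~ h) j z).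
Proof.
set s := qshift (qcol x y) j.
case: (altP (P s z =P z)) => [/eqP|nz].
  rewrite P0 => /andP[se /eqP ze].
  have je : j = (qcol x y).2 by move: (se : ~~ ((qcol x y).2 (+) j)); move: ((qcol x y).2) (j) => [] [].
  exists (inl (inl (inr (h, x, y, z.2)))); rewrite /quadr_block !in_quad -je.
  have -> : (qcol x y).1 = z.1 by rewrite ze.
  by rewrite -surjective_pairing !eqxx ?orbT.
case/orP: (lowP (PK s) nz) => lz.
  exists (inl (inr (h, exist (fun t => is_true (qlow t)) ((x, y), (j, z)) lz))).
  by rewrite /quadr_block /= !in_quad !eqxx ?orbT.
exists (inl (inr (h, exist (fun t => is_true (qlow t)) ((x, y), (j, P s z)) lz))).
by rewrite /quadr_block /= !in_quad PK !eqxx ?orbT.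
Qed.

Lemma cov_pair h i x x' j z : x != x' -> cov (qpt h i x) (qpt h i x') (qpt (~~ h) j z).
Proof.
move=> xx'; have [s e] := Pc xx'; subst x'; have nx : P s x != x by rewrite eq_sym.
(* The partner of [z] in its half for which the factor used on group [(h, i)] is the one containing
   the pair [x], [x']. *)
pose z' : V := ((s.1 - z.1)%R, s.2 (+) i (+) z.2).
have e1 : qshift (qcol z z') i = s.
  rewrite /qshift /qcol /z' /= addrC subrK; case: (s) => c e /=; congr (_, _).
  by move: e (i) (z.2) => [] [] [].
have e2 : qshift (qcol z' z) i = s.
  by rewrite -[RHS]e1 /qcol [(z.1 + _)%R]addrC [z.2 (+) _]addbC.
have [w lw hw] : exists2 w, low (P s) w & w = x \/ w = P s x.
  by case/orP: (lowP (PK s) nx) => lx; [exists x; [|left]|exists (P s x); [|right]].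
suff [t /and3P[a b c]] : exists t,
    [&& qpt h i w \in quadr_block t, qpt h i (P s w) \in quadr_block t & qpt (~~ h) j z \in quadr_block t].
  by exists t; case: hw a b => ->; rewrite ?PK => -> ->.
case: j.
  rewrite -e2 in lw.
  exists (inl (inr (~~ h, exist (fun t => is_true (qlow t)) ((z', z), (i, w)) lw))).
  by rewrite /quadr_block /= !in_quad negbK e2 !eqxx ?orbT.
rewrite -e1 in lw.
exists (inl (inr (~~ h, exist (fun t => is_true (qlow t)) ((z, z'), (i, w)) lw))).
by rewrite /quadr_block /= !in_quad negbK e1 !eqxx ?orbT.
Qed.

Lemma cov_half h x x' z : x != x' -> cov (qpt h false x) (qpt h false x') (qpt h true z).
Proof.
have [FK F0 Fc _] := fF; case/Fc=> c <-; have [i e] := sq_rep FK F0 c x z.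
by exists (inr (h, i)); rewrite /quadr_block e !in_quad !eqxx ?orbT.
Qed.

Lemma cov_half' h x x' z : x != x' -> cov (qpt h false z) (qpt h true x) (qpt h true x').
Proof.
have [FK F0 Fc _] := fF; case/Fc=> c <-; have [i e] := sq_rep FK F0 c z x.
by exists (inr (h, i)); rewrite /quadr_block e !in_quad !eqxx ?orbT.
Qed.

Definition qrank (x : T) : nat := match x with inl _ => 0 | inr (h, i, _) => 1 + 2 * h + i end.

Lemma quadr_design : design quadr_block.
Proof.
split.
- have qI h i : injective (qin h i) by move=> [x|x] [y|y] //= [->].
  have [v4 _ _] := dv.
  move=> [[[[[h i] b]|[[[h x] y] b]]|[h [[[x y] [j z]] lz]]]|[h t]]; rewrite /quadr_block /=;
    try exact: card_quad_le.
  by rewrite card_imset.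
- apply: (@covers_sorted _ _ _ qrank) => -[l|[[h i] x]] [l'|[[h' i'] x']] [l''|[[h'' i''] x'']] //= xy xz yz; try lia.
  + by case: l l' l'' xy xz yz => [] [] [].
  + by move=> _; apply: (@cov_group h'' i'' (inl l) (inl l') (inr x'')).
  + case: h' xy yz; case: i'; case: h'' xz; case: i'' => //= xz xy yz _.
    * by apply: (@cov_group true true (inl l) (inr x') (inr x'')); move: yz; apply: contraNneq => // -[->].
    * exact: (@cov_inf2 l true).
    * by apply: (@cov_group true false (inl l) (inr x') (inr x'')); move: yz; apply: contraNneq => // -[->].
    * exact: cov_inf.
    * exact: cov_inf.
    * by apply: (@cov_group false true (inl l) (inr x') (inr x'')); move: yz; apply: contraNneq => // -[->].
    * exact: cov_inf.
    * exact: cov_inf.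
    * exact: (@cov_inf2 l false).
    * by apply: (@cov_group false false (inl l) (inr x') (inr x'')); move: yz; apply: contraNneq => // -[->].
  + have E h0 i0 u w : qpt h0 i0 u != qpt h0 i0 w -> u != w by apply: contraNneq => ->.
    have G h0 i0 : qpt h0 i0 x != qpt h0 i0 x' -> qpt h0 i0 x != qpt h0 i0 x'' ->
       qpt h0 i0 x' != qpt h0 i0 x'' -> cov (qpt h0 i0 x) (qpt h0 i0 x') (qpt h0 i0 x'').
      move=> /E a /E b /E c; exact: (@cov_group h0 i0 (inr x) (inr x') (inr x'') a b c).
    have R a b c : cov b c a -> cov a b c by move/cov_perm2/cov_perm1.
    case: h xy xz; case: i; case: h' yz; case: i'; case: h''; case: i'' => //= yz xy xz _;
    solve [ exact: G | exact: cov_half (E _ _ _ _ xy) | exact: cov_half' (E _ _ _ _ yz)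
          | exact: (@cov_across false) | exact: R (@cov_across true _ _ _ _)
          | exact: (@cov_pair false _ _ _ _ _ (E _ _ _ _ xy))
          | exact: R (@cov_pair true _ _ _ _ _ (E _ _ _ _ yz)) ].
- have [FK F0 _ FC] := fF; have := sq_card FK F0; have := card_qpair; move: In.
  rewrite !card_sum !card_prod card_bool card_ord; rewrite card_V in FC.
  move: #|I| #|{: qpair_index}| #|{: sq_index F}| #|C| FC => a b c d FC.
  have {FC} -> : d = 2 * k + 1 by lia.
  move=> /= ha hb hc; lia.
Qed.
End Quadrupling.

Lemma fact_on (U : finType) k : fact #|U| k ->
  exists (C : finType) (p : C -> U -> U) (s t : 'I_k -> U) o, factK p s t o.
Proof.
case=> C [p [s [t [o [pf si ti st [so cl]]]]]].
exists C, (fun c x => enum_val (p c (enum_rank x))), (fun x => enum_val (s x)),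
  (fun x => enum_val (t x)), (enum_val o); split.
- by apply: one_fact_transport pf; [exact: enum_valK|exact: enum_rankK].
- by move=> x y /enum_val_inj/si.
- by move=> x y /enum_val_inj/ti.
- by move=> x y; rewrite (inj_eq enum_val_inj).
split=> [x|c x y]; first by rewrite !(inj_eq enum_val_inj).
rewrite !enum_valK => /enum_val_inj/cl h z; have [w e] := h z.
by exists w; rewrite !enum_valK e.
Qed.

Lemma mixed_fact_ex k : odd k.+1 || (4 <= k.+1) ->
  exists P : 'I_k.+1 * bool -> 'I_k.+1 * bool -> 'I_k.+1 * bool, mixed_fact P.
Proof.
case: (boolP (odd k.+1)) => [ko _|ke k4]; first exact: mixed_fact_odd.
by apply: mixed_fact_even; rewrite card_ord.
Qed.

Lemma sqs_quad k : sqs (2 * k.+1 + 2) -> odd k.+1 || (4 <= k.+1) -> sqs (8 * k.+1 + 2).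
Proof.
move=> su kk; have [P mP] := mixed_fact_ex kk.
have [||C [F fF]] := @one_fact_ex ('I_k.+1 * bool)%type; rewrite ?card_prod ?card_ord ?card_bool //; try lia.
have : sqs #|{: bool + 'I_k.+1 * bool}|.
  by rewrite card_sum card_prod card_ord card_bool addnC mulnC.
case/sqs_design_on=> I [v [dv In _]].
apply: (design_sqs (quadr_design mP fF dv In)).
by rewrite card_sum !card_prod card_ord card_bool; lia.
Qed.

Lemma flex_quad k m : sqs (2 * k.+1 + 2) -> odd k.+1 || (4 <= k.+1) -> fact (2 * k.+1) m ->
  flex (8 * k.+1 + 2) m.
Proof.
move=> su kk; have [P mP] := mixed_fact_ex kk.
have <- : #|{: 'I_k.+1 * bool}| = 2 * k.+1 by rewrite card_prod card_ord card_bool mulnC.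
case/fact_on=> C [F [s [t [o [fF si ti st [so cl]]]]]].
have : sqs #|{: bool + 'I_k.+1 * bool}|.
  by rewrite card_sum card_prod card_ord card_bool addnC mulnC.
case/sqs_design_on=> I [v [dv In _]].
have [FK F0 Fc _] := fF.
apply: (@four_flex _ _ _ _ (fun x => qpt false false (s x)) (fun x => qpt false false (t x))
  (fun x => qpt false true (s x)) (fun x => qpt false true (t x)) (qpt false false o) _ _
  (quadr_design mP fF dv In)).
- by rewrite card_sum !card_prod card_ord card_bool; lia.
- exact: card_ord.
- by split=> x y [] => [/si|/ti|/si|/ti].
- move=> x y; rewrite !(inj_eq (@inr_inj _ _)) !xpair_eqE /=.
  by rewrite ?(negbTE (st _ _)).
- move=> x; rewrite !(inj_eq (@inr_inj _ _)) !xpair_eqE /=.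
  by have /andP[-> ->] := so x.
- move=> x y z; have [c e] := Fc _ _ (st x y); have [w e'] := cl _ _ _ e z.
  have [i h] := sq_rep FK F0 c (s x) (s z).
  by exists w, (inr (false, i)); rewrite /quadr_block h e e'.
Qed.

(** * One-factorizations from a range of differences *)

Section EvenCyclic.
Variable h' : nat.
Notation h := h'.+1.
Notation G := 'I_(h'.*2).+2.
Open Scope ring_scope.

Lemma val_addI (x y : G) : nat_of_ord (x + y) = ((x + y) %% (h'.*2).+2)%N :> nat.
Proof. by []. Qed.

Lemma odd_addI (x y : G) : odd (nat_of_ord (x + y)) = odd x (+) odd y.
Proof. by rewrite val_addI odd_mod ?oddD //= odd_double. Qed.

Lemma odd_oppI (x : G) : odd (nat_of_ord (- x)) = odd x.
Proof.
have : odd (nat_of_ord (- x + x)) = false by rewrite addNr.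
by rewrite odd_addI; case: (odd (nat_of_ord (- x))); case: (odd x).
Qed.

Lemma inordD a b : (a + b < (h'.*2).+2)%N -> inord a + inord b = inord (a + b) :> G.
Proof.
move=> ab; apply: val_inj; rewrite /= !inordK ?modn_small //; lia.
Qed.

(* A difference is a nonzero even residue, an odd residue read from the even endpoint,
   or one of the excluded [+- 1, +- 3, ..., +- (2 r - 1)]. *)
Variable r : nat.
Definition odiff (j : nat) : G := inord (2 * j + 1).
Definition near (x y : G) : Prop := exists2 j, (j < r)%N & (y = x + odiff j \/ x = y + odiff j).

Definition shift_match (o x : G) : G := if odd x then x - o else x + o.

Lemma shift_matchK (o : G) : odd o -> involutive (shift_match o).
Proof.
move=> oo x; rewrite /shift_match; case: (boolP (odd x)) => ox.
  by rewrite odd_addI odd_oppI ox oo /= subrK.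
by rewrite odd_addI (negbTE ox) oo /= addrK.
Qed.

Lemma shift_match0 (o x : G) : odd o -> shift_match o x != x.
Proof.
move=> oo; apply: contraTneq oo => /(congr1 (odd \o val)) /=; rewrite /shift_match.
by case: ifP => ox; rewrite odd_addI ?odd_oppI ox; case: (odd o).
Qed.

Definition oshift (j : nat) : G := inord (2 * r + 1 + 2 * j).

Lemma odd_oshift j : (j < h - 2 * r)%N -> odd (oshift j).
Proof. by move=> jh; rewrite /oshift inordK; lia. Qed.

Lemma odd_cover (x y : G) : odd x != odd y -> ~ near x y ->
  exists2 j, (j < h - 2 * r)%N & shift_match (oshift j) x = y.
Proof.
wlog ox : x y / ~~ odd x.
  move=> W xy nxy; case: (boolP (odd x)) => ox; last exact: W.
  have [||| j jh e] := W y x; rewrite 1?eq_sym //.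
  - by move: xy; rewrite ox; case: (odd y).
  - by case=> j jr [] e; apply: nxy; exists j => //; [right|left].
  by exists j => //; rewrite -e shift_matchK // odd_oshift.
move=> xy nxy; have oy : odd y by move: xy; rewrite (negbTE ox); case: (odd y).
have oo : odd (nat_of_ord (y - x)) by rewrite odd_addI odd_oppI oy (negbTE ox).
have yo : y = x + inord (nat_of_ord (y - x)) by rewrite inord_val addrC subrK.
have := ltn_ord (y - x); move: (nat_of_ord (y - x)) oo yo => o oo yo ol.
case: (ltnP o (2 * r)%N) => o1.
  case: nxy; exists (o./2); first by lia.
  by left; rewrite yo /odiff; congr (_ + inord _); lia.
case: (ltnP ((h'.*2).+2 - 2 * r)%N o) => o2.
  case: nxy; exists (((h'.*2).+2 - o)./2)%N; first by lia.
  right; rewrite yo /odiff -addrA (_ : inord o + _ = 0) ?addr0 //.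
  have oG : (((h'.*2).+2 - o)./2 * 2 + 1 = (h'.*2).+2 - o)%N by lia.
  by apply: val_inj; rewrite /= mulnC oG !inordK; [rewrite subnKC ?modnn; lia|lia|lia].
exists ((o - 2 * r - 1)./2)%N; first by lia.
by rewrite /shift_match (negbTE ox) yo /oshift; congr (_ + inord _); lia.
Qed.

(** A one-factorization of the complete graph on Z_(2h) after removal of the differences +-1, ...,
    +-(2r - 1). These remove [2 * r] edges at each point, hence the number of colours. *)
Definition leave (C : finType) (p : C -> G -> G) : Prop :=
  [/\ forall c, involutive (p c), forall c x, p c x != x,
      forall x y, x != y -> ~ near x y -> exists c, p c x = y & #|C| = ((h'.*2).+1 - 2 * r)%N].

(** The even and the odd residues form two complete graphs of even order [h], factored in parallel;
    each remaining odd residue gives a matching by itself. *)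
Lemma leave_even : ~~ odd h -> (2 * r <= h)%N -> exists (C : finType) (p : C -> G -> G), leave p.
Proof.
move=> he rh; have [||C [p [pK p0 pc Cn]]] := @one_fact_ex 'I_h; rewrite ?card_ord //; first by lia.
pose q (c : C + 'I_(h - 2 * r)) (x : G) : G :=
  match c with
  | inl c => inord (odd x + 2 * p c (inord x./2))
  | inr j => shift_match (oshift j) x
  end.
have hh (x : G) : (x./2 < h)%N by have := ltn_ord x; lia.
have ql c (x : G) : q (inl c) x = (odd x + 2 * p c (inord x./2))%N :> nat.
  by rewrite /q inordK //; have := ltn_ord (p c (inord x./2)); case: (odd x); lia.
have ql1 c (x : G) : odd (q (inl c) x) = odd x by rewrite ql; case: (odd x); lia.
have ql2 c (x : G) : inord (q (inl c) x)./2 = p c (inord x./2).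
  rewrite ql; apply: val_inj => /=; rewrite inordK; case: (odd x); have := ltn_ord (p c (inord x./2)); lia.
exists (C + 'I_(h - 2 * r))%type, q; split.
- case=> [c|j] x; last by apply: shift_matchK; apply: odd_oshift.
  apply: ord_inj; rewrite ql ql1 ql2 pK inordK //=; have := odd_double_half x; lia.
- case=> [c|j] x; last by apply: shift_match0; apply: odd_oshift.
  by apply: contra (p0 c (inord x./2)) => /eqP e; rewrite -ql2 e.
- move=> x y xy nxy; case: (altP (odd x =P odd y)) => [o|o].
    have [|c e] := pc (inord x./2) (inord y./2).
      apply: contra xy => /eqP/(congr1 val) /=; rewrite !inordK // => e.
      by apply/eqP/val_inj => /=; rewrite -(odd_double_half x) -(odd_double_half y) e o.
    exists (inl c); apply: ord_inj; rewrite ql e inordK // o /=; have := odd_double_half y; lia.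
  by have [j jh e] := odd_cover o nxy; exists (inr (Ordinal jh)).
- by rewrite card_sum card_ord; move: Cn; rewrite card_ord; lia.
Qed.

(** Now the two parity classes have odd order. The reflection in an even [c] fixes [c] and [c + h],
    one point in each class, and these are joined to each other. This uses up the difference [h],
    which is odd. *)
Lemma leave_odd : odd h -> (2 * r < h)%N -> exists (C : finType) (p : C -> G -> G), leave p.
Proof.
move=> ho rh; pose H : G := inord h.
have Hv : val H = h by rewrite /= inordK //; lia.
have HH : H + H = 0 by apply: val_inj; rewrite /= Hv addnn -doubleS modnn.
have HN : - H = H by apply: (addrI H); rewrite subrr HH.
have H0 : H != 0 by rewrite -val_eqE /= Hv.
have oH : odd H by rewrite Hv.
have dbl0 (z : G) : z + z = 0 -> (z == 0) || (z == H).
  move/(congr1 val) => /=; rewrite -!val_eqE [val H]Hv /=; have := ltn_ord z.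
  case: (ltnP (z + z)%N (h'.*2).+2) => zz zl; first by rewrite modn_small //; lia.
  have -> : (z + z = (h'.*2).+2 + (z + z - (h'.*2).+2))%N by lia.
  by rewrite modnDl modn_small; lia.
pose e2 (c : 'I_h) : G := inord (2 * c).
have e2e c : odd (e2 c) = false by rewrite /e2 inordK; have := ltn_ord c; lia.
have e2s (z : G) : ~~ odd z -> exists c, e2 c = z.
  move=> oz; have zh : (z./2 < h)%N by have := ltn_ord z; lia.
  by exists (Ordinal zh); rewrite /e2 -[RHS]inord_val; congr inord => /=; lia.
pose ax (z : G) := (z == 0) || (z == H).
have axN z : ax (- z) = ax z by rewrite /ax oppr_eq0 -{1}HN (inj_eq oppr_inj).
have axH z : ax (z + H) = ax z.
  by rewrite /ax addr_eq0 HN orbC -[z + H == H]subr_eq0 addrK.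
pose m := (h - 2 * r)%N; have m0 : (0 < m)%N by rewrite /m; lia.
(* The middle index, where [oshift j0] is [h]: this shift is already covered by the reflections and
   is skipped by [lift j0]. *)
pose j0 : 'I_m.-1.+1 := inord (m.-1)./2.
pose q (c : 'I_h + 'I_m.-1) (x : G) : G :=
  match c with
  | inl c => if ax (x - e2 c) then x + H else e2 c + e2 c - x
  | inr j => shift_match (oshift (lift j0 j)) x
  end.
have jm (j : 'I_m.-1) : (lift j0 j < h - 2 * r)%N.
  by apply: (leq_trans (ltn_ord (lift j0 j))); rewrite prednK.
exists ('I_h + 'I_m.-1)%type, q; split.
- case=> [c|j] x; last by apply: shift_matchK; apply: odd_oshift.
  rewrite /q; case: (boolP (ax (x - e2 c))) => hx.
    by rewrite addrAC axH hx -addrA HH addr0.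
  have -> : e2 c + e2 c - x - e2 c = - (x - e2 c) by rewrite opprB addrAC addrK.
  by rewrite axN (negbTE hx) subKr.
- case=> [c|j] x; last by apply: shift_match0; apply: odd_oshift.
  rewrite /q; case: ifP => hx; first by rewrite -{2}[x]addr0 (inj_eq (addrI x)).
  apply: contraFneq hx => e; apply: dbl0; rewrite addrACA -opprD -{1}e subrK subrr //.
- move=> x y xy nxy; case: (altP (odd x =P odd y)) => [o|o].
    have [z [oz zz]] : exists z : G, ~~ odd z /\ z + z = x + y.
      have lx := ltn_ord x; have ly := ltn_ord y.
      pose a : G := inord (x + y)./2.
      have aa : a + a = x + y.
        apply: val_inj => /=; rewrite inordK; last by lia.
        by congr (_ %% _)%N; lia.
      (* Half of [x + y] is determined only up to adding [H]; as [H] is odd, one of the two halves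
         is even. *)
      case: (boolP (odd a)) => oa; last by exists a.
      by exists (a + H); rewrite odd_addI oa oH; split=> //; rewrite addrACA HH addr0.
    have [c ec] := e2s z oz; exists (inl c); rewrite /q ec.
    have -> : z + z - x = y by rewrite zz addrC addKr.
    case: ifP => // /orP[]; rewrite subr_eq ?add0r => /eqP xe; case/eqP: xy.
      by rewrite xe; apply: (addrI x); rewrite -zz xe.
    rewrite xe; apply: (addrI x); rewrite -zz {1}xe.
    by rewrite addrACA HH add0r.
  case: (altP (y - x =P H)) => [e|ne].
    have ye : y = x + H by rewrite -e addrC subrK.
    case: (boolP (odd x)) => ox.
      have [|c ec] := e2s (x + H); first by rewrite odd_addI ox oH.
      by exists (inl c); rewrite /q ec opprD addrA subrr sub0r axN /ax eqxx orbT ye.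
    have [c ec] := e2s x ox; exists (inl c); rewrite /q ec subrr /ax eqxx.
    by rewrite ye.
  have [j jh e] := odd_cover o nxy.
  have jm' : (j < m.-1.+1)%N by rewrite prednK.
  case: (unliftP j0 (Ordinal jm')) => [i ji|ji].
    by exists (inr i); rewrite /q -ji.
  case/eqP: ne; have oj : oshift j = H.
    rewrite /oshift /H; congr inord.
    have -> : j = (m.-1)./2.
      have /(congr1 val) /= := ji; rewrite /j0 inordK //; lia.
    by rewrite /m; lia.
  rewrite -e oj /shift_match; case: ifP => _; first by rewrite addrC addKr HN.
  by rewrite addrC addKr.
- by rewrite card_sum !card_ord /m; lia.
Qed.
End EvenCyclic.

(** * Order 3u - 2s with a subsystem of order u *)

Lemma zsub3 (V : zmodType) (d a b : V) : (d - (d - a - b) - a = b)%R.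
Proof. by rewrite -[(d - a - b)%R]addrA -opprD subKr addrC addKr. Qed.

Lemma zadd3 (V : zmodType) (a b c : V) : (a + b + c - a - b = c)%R.
Proof. by rewrite -[LHS]addrA -opprD [(a + b + c)%R]addrC addrK. Qed.

Lemma ord3_enum (i : 'I_3) : [\/ i = 0%R, i = 1%R | i = (1 + 1)%R].
Proof.
by case: i => [[|[|[|]]]] // ?; [constructor 1|constructor 2|constructor 3]; apply: val_inj.
Qed.

Section Tripling.
Variables (h' s r : nat).
Notation g := (h'.*2).+2.
Notation G := 'I_g.
Notation T := ('I_s + 'I_3 * G)%type.
Hypotheses (gr : g = s + 6 * r) (s24 : (s == 2) || (s == 4)).
Variables (C J : finType) (p : C -> G -> G) (w : J -> {set T}).

Definition tpt (i : 'I_3) (x : G) : T := inr (i, x).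
Definition tin (i : 'I_3) (x : 'I_s + G) : T := match x with inl t => inl t | inr x => tpt i x end.

Hypothesis lp : leave r p.
Hypothesis w4 : forall j, #|w j| <= 4.
Hypothesis wc : forall i x y z, x != y -> x != z -> y != z ->
  exists j, [&& tin i x \in w j, tin i y \in w j & tin i z \in w j].
Hypothesis wn : 24 * #|J| + 2 * (s * s.-1 * s.-2) <= 3 * ((g + s) * (g + s).-1 * (g + s).-2).

(** The lower value of the [j]-th nested pair of the [i]-th interval; adding [2 * j + 1] gives the
    upper value [2 * r * i + r + j]. *)
Definition tsum (i j : nat) : G := inord (2 * r * i + (r - 1 - j)).

Definition trip_index := ('I_s * G * G + 'I_3 * 'I_r * G * G + 'I_3 * sq_index p + J)%type.

(* Transversal triples are sorted by their sum in [Z_g]: the last [s] values go with the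
   infinite points; the values in [2 r i, 2 r (i + 1)) are matched by nested pairs,
   whose differences 1, 3, ..., 2 r - 1 are used for pairs inside the group [i]. *)
Definition trip_block (b : trip_index) : {set T} :=
  match b with
  | inl (inl (inl (t, x, y))) =>
      quad (inl t) (tpt 0%R x) (tpt 1%R y) (tpt (1 + 1)%R (inord (6 * r + t) - x - y)%R)
  | inl (inl (inr (i, j, x, y))) =>
      quad (tpt i x) (tpt i (x + odiff h' j)%R) (tpt (i + 1)%R y) (tpt (i + 1 + 1)%R (tsum i j - x - y)%R)
  | inl (inr (i, t)) => sq_block p (tpt i) (tpt (i + 1)%R) (val t)
  | inr j => w j
  end.

Definition tcov (x y z : T) := exists i, [&& x \in trip_block i, y \in trip_block i & z \in trip_block i].

Lemma tcov_perm1 x y z : tcov x y z -> tcov y x z.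
Proof. by case=> i /and3P[a b c]; exists i; rewrite a b c. Qed.

Lemma tcov_perm2 x y z : tcov x y z -> tcov x z y.
Proof. by case=> i /and3P[a b c]; exists i; rewrite a b c. Qed.

Lemma tcov_group i x y z : x != y -> x != z -> y != z -> tcov (tin i x) (tin i y) (tin i z).
Proof. by move=> xy xz yz; have [j h] := wc i xy xz yz; exists (inr j). Qed.

Lemma ord3_add1 (i : 'I_3) : (i + 1 + 1 + 1 = i)%R.
Proof. by apply: val_inj; case: i => [[|[|[|]]]]. Qed.

Lemma ord3_cases (i j : 'I_3) : i != j -> j = (i + 1)%R \/ j = (i + 1 + 1)%R.
Proof.
by case: i => [[|[|[|]]]] // ?; case: j => [[|[|[|]]]] // ? _; [left|right|right|left|left|right]; apply: val_inj.
Qed.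

Lemma tcov_inf t i j x y : i != j -> tcov (inl t) (tpt i x) (tpt j y).
Proof.
have A a b : tcov (inl t) (tpt 0%R a) (tpt 1%R b).
  by exists (inl (inl (inl (t, a, b)))); rewrite /trip_block !in_quad !eqxx ?orbT.
have B a b : tcov (inl t) (tpt 0%R a) (tpt (1 + 1)%R b).
  exists (inl (inl (inl (t, a, inord (6 * r + t) - a - b)%R))).
  by rewrite /trip_block !in_quad [(_ - _ - (_ - _))%R]subKr !eqxx ?orbT.
have D a b : tcov (inl t) (tpt 1%R a) (tpt (1 + 1)%R b).
  exists (inl (inl (inl (t, inord (6 * r + t) - a - b, a)%R))).
  by rewrite /trip_block !in_quad zsub3 !eqxx ?orbT.
case: (ord3_enum i) => ->; case: (ord3_enum j) => -> // _.
- by apply: tcov_perm2; apply: A.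
- by apply: tcov_perm2; apply: B.
- by apply: tcov_perm2; apply: D.
Qed.

Lemma tcov_trans a b c : tcov (tpt 0%R a) (tpt 1%R b) (tpt (1 + 1)%R c).
Proof.
have := inord_val (a + b + c)%R; have := ltn_ord (a + b + c)%R.
move: (nat_of_ord (a + b + c)%R) => d dg dE.
case: (leqP (6 * r) d) => d6.
  have ts : d - 6 * r < s by move: dg; rewrite gr; lia.
  exists (inl (inl (inl (Ordinal ts, a, b)))).
  rewrite /trip_block !in_quad /= subnKC // dE.
  by rewrite zadd3 !eqxx ?orbT.
have r0 : 0 < r by lia.
have i3 : d %/ (2 * r) < 3 by rewrite ltn_divLR; lia.
have tl : d %% (2 * r) < 2 * r by rewrite ltn_mod; lia.
have dE' : 2 * r * (d %/ (2 * r)) + d %% (2 * r) = d by rewrite [X in X + _]mulnC -divn_eq.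
move: (d %/ (2 * r)) (d %% (2 * r)) i3 tl dE' => i t i3 tl dE'.
(* The offset [t] is either the lower value [r - 1 - j] or the upper value [r + j] of a nested
   pair. *)
have [j [jr e]] : exists j, j < r /\ (t + j + 1 = r \/ r + j = t).
  by case: (ltnP t r) => tr; [exists (r - 1 - t)|exists (t - r)]; lia.
pose io : 'I_3 := Ordinal i3; pose jo : 'I_r := Ordinal jr.
(* The point [u] of group [io] is the first point of its block if the sum is the lower value, and
   the second point if it is the upper one. *)
have key u y z : (u + y + z = a + b + c)%R -> exists x,
   [/\ u == x \/ u == (x + odiff h' j)%R & (z = tsum io jo - x - y)%R].
  move=> uE; case: e => e.
    exists u; split; first by left.
    rewrite /tsum /= (_ : _ + _ = d); last by lia.
    by rewrite dE -uE zadd3.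
  exists (u - odiff h' j)%R; split; first by right; rewrite subrK.
  have eS : (tsum io jo + odiff h' j = u + y + z)%R.
    rewrite uE -dE /tsum /odiff inordD; first by congr inord => /=; lia.
    by rewrite /=; lia.
  by rewrite opprB addrA eS zadd3.
have cov3 u y z : (u + y + z = a + b + c)%R ->
    tcov (tpt io u) (tpt (io + 1)%R y) (tpt (io + 1 + 1)%R z).
  move=> uE; have [x [ux ->]] := key u y z uE.
  exists (inl (inl (inr (io, jo, x, y)))); rewrite /trip_block !in_quad !eqxx ?orbT !andbT.
  by case: ux => /eqP ->; rewrite eqxx ?orbT.
have o3 : (1 + 1 + 1 = 0 :> 'I_3)%R by apply: val_inj.
have o4 : (1 + 1 + 1 + 1 = 1 :> 'I_3)%R by apply: val_inj.
case: (ord3_enum io) cov3 => -> cov3.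
- by have := cov3 a b c erefl; rewrite add0r.
- apply: tcov_perm1; apply: tcov_perm2; rewrite -o3; apply: cov3.
  by rewrite addrC addrA.
- apply: tcov_perm2; apply: tcov_perm1; have := cov3 c a b.
  by rewrite o4 o3; apply; rewrite -addrA addrC.
Qed.

Lemma tcov_pair i j x x' z : i != j -> x != x' -> tcov (tpt i x) (tpt i x') (tpt j z).
Proof.
move=> ij; have [pK p0 pc _] := lp.
have N a k : k < r -> tcov (tpt i a) (tpt i (a + odiff h' k)%R) (tpt j z).
  move=> kr; case: (ord3_cases ij) => ->.
    exists (inl (inl (inr (i, Ordinal kr, a, z)))).
    by rewrite /trip_block !in_quad !eqxx ?orbT.
  exists (inl (inl (inr (i, Ordinal kr, a, tsum i k - a - z)%R))).
  by rewrite /trip_block !in_quad subKr !eqxx ?orbT.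
case: (boolP [exists k : 'I_r, (x' == x + odiff h' k)%R || (x == x' + odiff h' k)%R]).
  case/existsP=> k /orP[] /eqP-> _; first exact: N.
  by apply/tcov_perm1/N.
move=> nn /pc[|c <-].
  case=> k kr e; case/existsP: nn; exists (Ordinal kr).
  by case: e => ->; rewrite eqxx ?orbT.
case: (ord3_cases ij) => ji.
  have [t e] := sq_rep pK p0 c x z; exists (inl (inr (i, t))).
  by rewrite /trip_block e ji !in_quad !eqxx ?orbT.
have [t e] := sq_rep pK p0 c z x; exists (inl (inr (j, t))).
have <- : (j + 1 = i)%R by rewrite ji ord3_add1.
by rewrite /trip_block e !in_quad !eqxx ?orbT.
Qed.

Definition trank (x : T) : nat := match x with inl _ => 0 | inr (i, _) => i.+1 end.

Lemma trip_design : design trip_block.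
Proof.
have [pK p0 pc Cn] := lp.
split.
- move=> [[[[[t x] y]|[[[i j] x] y]]|[i t]]|j]; rewrite /trip_block;
    [exact: card_quad_le|exact: card_quad_le|exact: card_quad_le|exact: w4].
- apply: (@covers_sorted _ _ _ trank) => -[l|[i x]] [l'|[i' x']] [l''|[i'' x'']] //= xy xz yz; try lia.
  + by move=> _; apply: (tcov_group 0%R (x := inl l) (y := inl l') (z := inl l'')).
  + by move=> _; apply: (tcov_group i'' (x := inl l) (y := inl l') (z := inr x'')).
  + move=> _; case: (altP (i' =P i'')) yz => [<-|ii] yz; last exact: tcov_inf.
    apply: (tcov_group i' (x := inl l) (y := inr x') (z := inr x'')) => //.
    by apply: contraNneq yz => e; rewrite (inr_inj e) eqxx.
  + move=> le; case: (altP (i =P i')) xy yz le => [<-|ii] xy yz le; last first.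
      case: (altP (i' =P i'')) yz => [<-|ii'] yz.
        apply: tcov_perm1; apply: tcov_perm2; apply: tcov_pair; first by rewrite eq_sym.
        by apply: contraNneq yz => ->.
      have := tcov_trans x x' x''; move: ii ii' le; case: (ord3_enum i) => ->;
        by case: (ord3_enum i') => -> //; case: (ord3_enum i'') => ->.
    have xx' : x != x' by apply: contraNneq xy => ->.
    case: (altP (i =P i'')) xz yz => [<-|ii] xz yz; last exact: tcov_pair.
    apply: (tcov_group i (x := inr x) (y := inr x') (z := inr x'')) => //.
      by apply: contraNneq xz => e; rewrite (inr_inj e) eqxx.
    by apply: contraNneq yz => e; rewrite (inr_inj e) eqxx.
- have := sq_card pK p0; rewrite Cn card_ord => c4; move: wn.
  rewrite !card_sum !card_prod !card_ord.
  move: #|J| #|{: sq_index p}| c4 => a b c4.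
  have eh : h'.*2.+1 - 2 * r = s + 4 * r - 1 by move: gr s24; lia.
  rewrite eh gr in c4 *; case/orP: s24 => /eqP es; rewrite es in c4 *.
    have e1 : 2 + 4 * r - 1 = 4 * r + 1 by lia.
    have e2 : (2 + 6 * r + 2).-1 = 6 * r + 3 by lia.
    have e3 : (6 * r + 3).-1 = 6 * r + 2 by lia.
    have e4 : (2 + 3 * (2 + 6 * r)).-1 = 18 * r + 7 by lia.
    have e5 : (18 * r + 7).-1 = 18 * r + 6 by lia.
    rewrite e1 in c4; rewrite e2 e3 e4 e5 /=; lia.
  have e1 : 4 + 4 * r - 1 = 4 * r + 3 by lia.
  have e2 : (4 + 6 * r + 4).-1 = 6 * r + 7 by lia.
  have e3 : (6 * r + 7).-1 = 6 * r + 6 by lia.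
  have e4 : (4 + 3 * (4 + 6 * r)).-1 = 18 * r + 15 by lia.
  have e5 : (18 * r + 15).-1 = 18 * r + 14 by lia.
  rewrite e1 in c4; rewrite e2 e3 e4 e5 /=; lia.
Qed.
End Tripling.

Lemma bij_split (U A B : finType) (S : {set U}) : #|S| = #|A| -> #|~: S| = #|B| ->
  exists (f : U -> A + B) (f' : A + B -> U),
    [/\ cancel f f', cancel f' f & forall x, x \in S -> exists a, f x = inl a].
Proof.
move=> cA cB.
pose f' (x : A + B) : U := match x with
  | inl a => enum_val (cast_ord (esym cA) (enum_rank a))
  | inr b => enum_val (cast_ord (esym cB) (enum_rank b)) end.
have fS a : f' (inl a) \in S by apply: enum_valP.
have fS' b : f' (inr b) \notin S by have := enum_valP (cast_ord (esym cB) (enum_rank b)); rewrite inE.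
have f'I : injective f'.
  move=> [a|b] [a'|b'] //.
  - by move/enum_val_inj/cast_ord_inj/enum_rank_inj->.
  - by move=> e; have := fS' b'; rewrite -e fS.
  - by move=> e; have := fS' b; rewrite e fS.
  - by move/enum_val_inj/cast_ord_inj/enum_rank_inj->.
have [|f fK gK] := inj_card_bij f'I; first by rewrite card_sum -cA -cB cardsC.
exists f, f'; split=> // x xS; case e : (f x) => [a|b]; first by exists a.
by have := fS' b; rewrite -e gK xS.
Qed.

(** Required of every system on [n] points, so that the one carrying the Latin cube can be the one
    embedded. *)
Definition embeds (n N : nat) : Prop := forall B : {set {set 'I_n}}, is_sqs B ->
  exists (T I : finType) (v : I -> {set T}) (e : 'I_n -> T),
    [/\ design v, #|T| = N, injective e & forall b, b \in B -> exists i, v i = e @: b].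

Lemma embeds_sqs n N : embeds n N -> sqs n -> sqs N.
Proof. by move=> E [B /E [T [I [v [e [dv TN _ _]]]]]]; apply: (design_sqs dv TN). Qed.

Lemma embeds_flex n N k : embeds n N -> flex n k -> flex N k.
Proof.
move=> E [B [f [o [/E [T [I [v [e [dv TN ei eB]]]]] fi fo fB]]]].
apply: (design_flex (f := e \o f) (o := e o) dv TN (card_ord k)).
- exact: inj_comp.
- by move=> p; rewrite /= (inj_eq ei).
- move=> x y z; have [w /eB [i vi]] := fB x y z; exists w, i.
  by rewrite vi /quad !imsetU !imset_set1.
Qed.

Lemma embeds_triple h' r s : (h'.*2).+2 = s + 6 * r -> (s == 2) || (s == 4) ->
  (2 * r < h'.+1) -> embeds (s + (h'.*2).+2) (s + 3 * (h'.*2).+2).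
Proof.
set g := (h'.*2).+2 => gr s24 rh B sB.
have [C [p lp]] : exists (C : finType) (p : C -> 'I_g -> 'I_g), leave r p.
  by case: (boolP (odd h'.+1)) => ho; [apply: leave_odd|apply: leave_even => //; apply: ltnW].
have [S [cS SB]] : exists S : {set 'I_(s + g)}, #|S| = s /\ (s = 4 -> S \in B).
  case/orP: s24 => /eqP es; subst s.
    exists [set inord 0; inord 1]; split=> //; rewrite cards2 -val_eqE /= !inordK //.
  have [||| b bB _] := @sqs_cover _ _ sB (inord 0) (inord 1) (inord 2);
    rewrite -?val_eqE /= ?inordK //.
  by exists b; split=> //; apply: sqs_card4 bB.
have [||f [f' [fK f'K fS]]] := @bij_split _ 'I_s 'I_g S; rewrite ?card_ord //.
  by rewrite cardsCs setCK card_ord cS; lia.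
have fi := can_inj fK.
have ti i : injective (@tin h' s i) by move=> [x|x] [y|y] //= [->].
have sc := sqs_card sB; rewrite card_ord in sc.
(* For [s = 4] the stem [S] is a block shared by the three copies of the system: it is removed from
   each copy and put back once. For [s = 2] nothing is shared. *)
pose J := ('I_3 * {b | (b \in B) && ((s == 4) ==> (b != S))} + {t : unit | s == 4})%type.
pose w (j : J) : {set 'I_s + 'I_3 * 'I_g} :=
  match j with inl (i, b) => tin i @: (f @: val b) | inr _ => tin 0%R @: (f @: S) end.
have w4 j : #|w j| <= 4.
  case: j => [[i [b /= /andP[bB _]]]|[t /= /eqP es]]; rewrite /w /= !card_imset //.
    by rewrite (sqs_card4 sB bB).
  by rewrite cS es.
have wB i b : b \in B -> exists j, w j = tin i @: (f @: b).
  move=> bB; case: (boolP ((s == 4) ==> (b != S))) => [bS|].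
    have bP : (b \in B) && ((s == 4) ==> (b != S)) by rewrite bB.
    by exists (inl (i, exist _ b bP)).
  rewrite negb_imply negbK => /andP[es /eqP ->].
  exists (inr (exist _ tt es)); rewrite /w -!imset_comp; apply: eq_in_imset => x xS /=.
  by have [a ->] := fS x xS.
have wc i x y z : x != y -> x != z -> y != z ->
    exists j, [&& tin i x \in w j, tin i y \in w j & tin i z \in w j].
  move=> xy xz yz; have f'I := can_inj f'K.
  have [|||b bB /and3P[xb yb zb]] := @sqs_cover _ _ sB (f' x) (f' y) (f' z);
    rewrite ?(inj_eq f'I) //.
  have [j e] := wB i b bB; exists j; rewrite e.
  by rewrite -[x]f'K -[y]f'K -[z]f'K !imset_f.
have wn : 24 * #|{: J}| + 2 * (s * s.-1 * s.-2) <= 3 * ((g + s) * (g + s).-1 * (g + s).-2).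
  rewrite [g + s]addnC -sc card_sum card_prod !card_sig card_ord.
  have cu (b : bool) : #|[pred t : unit | b]| = b.
    case: b; last by apply: eq_card0.
    by rewrite [RHS](esym card_unit); apply: eq_card.
  rewrite cu; case/orP: s24 => /eqP es.
    have s4 : (s == 4) = false by rewrite es.
    have -> : #|[pred b | (b \in B) && ((s == 4) ==> (b != S))]| = #|B|.
      by apply: eq_card => b; rewrite !inE s4 andbT.
    by move: #|B| => nB; rewrite es /=; lia.
  have s4 : (s == 4) = true by rewrite es.
  have -> : #|[pred b | (b \in B) && ((s == 4) ==> (b != S))]| = #|B :\ S|.
    by apply: eq_card => b; rewrite !inE s4 /= andbC.
  by have := cardsD1 S B; rewrite (SB es); move: #|B| #|B :\ S| => nB nB'; rewrite es /=; lia.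
exists ('I_s + 'I_3 * 'I_g)%type, (@trip_index h' s r C J p), (@trip_block h' s r C J p w), (fun x => tin 0%R (f x)); split.
- exact: (trip_design gr s24 lp w4 wc wn).
- by rewrite card_sum card_prod !card_ord.
- by move=> x y /ti/fi.
- by move=> b /(wB 0%R)[j e]; exists (inr j); rewrite /trip_block e -imset_comp.
Qed.

(** * Weighting the points of a quadruple system *)

(** Deleting [o] from the blocks through it leaves a Steiner triple system on the other points; the
    pairs avoiding [o] are counted in two ways. *)
Lemma sqs_through (T : finType) (B : {set {set T}}) (o : T) : is_sqs B ->
  6 * #|[set b in B | o \in b]| = #|T|.-1 * #|T|.-2.
Proof.
move=> sB; pose I0 := {b | b \in [set b in B | o \in b]}.
have bP (i : I0) : val i \in B /\ o \in val i.
  by have := valP i; rewrite inE => /andP.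
have := @sum_subsets T I0 (fun i => val i :\ o) 2.
rewrite (eq_bigr (fun=> 3)) => [|i _]; last first.
  have [bB bo] := bP i; have := cardsD1 o (val i); rewrite bo (sqs_card4 sB bB).
  by rewrite add1n => -[<-].
rewrite sum_nat_const card_sig.
have -> : #|[pred b | b \in [set b in B | o \in b]]| = #|[set b in B | o \in b]|.
  by apply: eq_card.
move=> h; have <- : \sum_(A : {set T} | (A \subset [set~ o]) && (#|A| == 2)) 1 * 2 = #|T|.-1 * #|T|.-2.
  rewrite sum_nat_const.
  have -> : #|[pred A : {set T} | (A \subset [set~ o]) && (#|A| == 2)]| = 'C(#|T|.-1, 2).
    rewrite -(cardsC1 o) -cards_draws; apply: eq_card => A; by rewrite !inE.
  by rewrite -[2]/(2`!) mul1n bin_ffact ffactnS ffactn1.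
rewrite -big_distrl /=; suff e : \sum_(A : {set T} | (A \subset [set~ o]) && (#|A| == 2)) 1 =
   \sum_(A : {set T} | #|A| == 2) #|[set i : I0 | A \subset val i :\ o]|.
  by rewrite e h -mulnA mulnC.
rewrite [RHS](bigID (fun A : {set T} => A \subset [set~ o])) /= [X in _ = _ + X]big1 ?addn0.
  apply: eq_big => [A|A /andP[Ao /cards2P[x [y [xy Axy]]]]]; first by rewrite andbC.
  have [ox oy] : o != x /\ o != y.
    split; apply: contraTneq Ao => ->; rewrite Axy; apply/subsetPn.
      by exists x; rewrite !inE eqxx.
    by exists y; rewrite !inE eqxx ?orbT.
  have [b bB /and3P[bo bx by']] := sqs_cover sB ox oy xy.
  have bI : b \in [set b in B | o \in b] by rewrite inE bB.
  apply/esym/eqP/cards1P; exists (exist _ b bI); apply/setP=> i; rewrite !inE.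
  have [iB io] := bP i; apply/idP/eqP=> [/subsetP s|->].
    apply: val_inj => /=; have xi := s x; have yi := s y.
    move: xi yi; rewrite Axy !inE !eqxx ?orbT => /(_ isT)/andP[_ xi] /(_ isT)/andP[_ yi].
    apply: (sqs_unique sB (cards3 ox oy xy) iB bB); apply/subsetP=> t.
      by rewrite !inE => /orP[/orP[]|] /eqP->.
    by rewrite !inE => /orP[/orP[]|] /eqP->.
  apply/subsetP=> t; rewrite Axy !inE /= => /orP[] /eqP->.
    by rewrite eq_sym ox.
  by rewrite eq_sym oy.
move=> A /andP[_ Ao]; apply/eqP; rewrite cards_eq0; apply/eqP/setP=> i; rewrite !inE.
by apply: contraNF Ao => /subset_trans; apply; apply/subsetP=> t; rewrite !inE => /andP[].
Qed.

Definition mixed (s : nat) (A W : finType) (x y : 'I_s + A * W) : bool :=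
  if (x, y) is (inr a, inr b) then a.1 != b.1 else false.

(* A candelabra system: blocks on three groups [W] and a stem of [s] points covering exactly
   the triples not inside one group plus the stem. *)
Definition candelabra (s : nat) (W K : finType) (c : K -> {set 'I_s + 'I_3 * W}) : Prop :=
  (forall k, #|c k| <= 4) /\
  (forall x y z, x != y -> x != z -> y != z -> mixed y z ->
     exists k, [&& x \in c k, y \in c k & z \in c k]).

Section Weight.
Variables (s w' m : nat) (K F : finType).
Notation W := 'I_w'.+1.
Variables (c : K -> {set 'I_s + 'I_3 * W}) (f : F -> {set 'I_s + W}).
Hypotheses (cc : candelabra c) (df : design f) (m0 : 0 < m).
Variables (B : {set {set unit + 'I_m}}).
Hypothesis sB : is_sqs B.
Notation o := (inl tt : unit + 'I_m).
Notation T := ('I_s + 'I_m * W)%type.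

Definition wI0 := {b | b \in [set b in B | o \in b]}.
Definition wI1 := {b | b \in [set b in B | o \notin b]}.

Definition trace (b : {set unit + 'I_m}) : {set 'I_m} := [set x | inr x \in b].

Lemma card_trace b : b \in B -> #|trace b| = 4 - (o \in b).
Proof.
move=> bB; rewrite -(sqs_card4 sB bB) (cardsD1 o b) addKn.
rewrite -(card_imset (trace b) (@inr_inj unit 'I_m)).
apply: eq_card => -[[]|x]; rewrite !inE /=; first by apply/negbTE/imsetP=> -[].
by apply/imsetP/idP=> [[y]|h]; [rewrite inE => h [->]|exists x; rewrite ?inE].
Qed.

Lemma wI0P (i : wI0) : val i \in B /\ o \in val i.
Proof. by have := valP i; rewrite inE => /andP. Qed.

Lemma wI1P (i : wI1) : val i \in B /\ o \notin val i.
Proof. by have := valP i; rewrite inE => /andP. Qed.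

Lemma card_wI0 (i : wI0) : 3 = #|trace (val i)|.
Proof. by have [bB bo] := wI0P i; rewrite card_trace ?bo. Qed.

Lemma card_wI1 (i : wI1) : 4 = #|trace (val i)|.
Proof. by have [bB /negbTE bo] := wI1P i; rewrite card_trace ?bo. Qed.

Definition n0 (i : wI0) (p : 'I_3) : 'I_m := enum_val (cast_ord (card_wI0 i) p).
Definition n1 (i : wI1) (p : 'I_4) : 'I_m := enum_val (cast_ord (card_wI1 i) p).

Lemma n0_onto (i : wI0) x : inr x \in val i -> exists p, n0 i p = x.
Proof.
move=> xi; have xt : x \in trace (val i) by rewrite inE.
exists (cast_ord (esym (card_wI0 i)) (enum_rank_in xt x)).
by rewrite /n0 cast_ordKV enum_rankK_in.
Qed.

Lemma n1_onto (i : wI1) x : inr x \in val i -> exists p, n1 i p = x.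
Proof.
move=> xi; have xt : x \in trace (val i) by rewrite inE.
exists (cast_ord (esym (card_wI1 i)) (enum_rank_in xt x)).
by rewrite /n1 cast_ordKV enum_rankK_in.
Qed.

Definition lift0 (i : wI0) (x : 'I_s + 'I_3 * W) : T :=
  match x with inl l => inl l | inr (p, a) => inr (n0 i p, a) end.
Definition lift2 (x : 'I_m) (y : 'I_s + W) : T :=
  match y with inl l => inl l | inr a => inr (x, a) end.

(** Quadruples with sum zero in the cyclic group, so any three coordinates determine the fourth. *)
Definition zsum4 (a : W * W * W) (p : 'I_4) : W :=
  match val p with 0 => a.1.1 | 1 => a.1.2 | 2 => a.2 | _ => (- (a.1.1 + a.1.2 + a.2))%R end.

Lemma zsum4_ex (h : 'I_4 -> W) (t : 'I_4) : exists a, forall p, p != t -> zsum4 a p = h p.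
Proof.
pose q k : 'I_4 := inord k; have qv (p : 'I_4) : p = q (val p) by rewrite /q inord_val.
have L1 (a b d : W) : (- (- (a + b + d) + a + b) = d)%R.
  by rewrite -[(_ + a + b)%R]addrA opprD opprK [LHS]addrC addKr.
have L2 (a b d : W) : (- (a - (a + b + d) + b) = d)%R by rewrite addrAC opprB [LHS]addrC addKr.
have L3 (a b d : W) : (- (a + b - (a + b + d)) = d)%R by rewrite opprB [LHS]addrC addKr.
have red a : (forall k, k < 4 -> k != val t -> zsum4 a (q k) = h (q k)) ->
    exists a, forall p, p != t -> zsum4 a p = h p.
  by move=> H; exists a => p pt; rewrite (qv p); apply: H; [exact: ltn_ord|exact: pt].
have qE k : k < 4 -> val (q k) = k by move=> k4; rewrite /= inordK.
case tv : (val t) (ltn_ord t) => [|[|[|[|//]]]] _.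
- apply: (red (- (h (q 1) + h (q 2) + h (q 3)), h (q 1), h (q 2))%R); rewrite tv.
  by move=> [|[|[|[|//]]]] k4 // _; rewrite /zsum4 qE //= L1.
- apply: (red (h (q 0), - (h (q 0) + h (q 2) + h (q 3)), h (q 2))%R); rewrite tv.
  by move=> [|[|[|[|//]]]] k4 // _; rewrite /zsum4 qE //= L2.
- apply: (red (h (q 0), h (q 1), - (h (q 0) + h (q 1) + h (q 3)))%R); rewrite tv.
  by move=> [|[|[|[|//]]]] k4 // _; rewrite /zsum4 qE //= L3.
- apply: (red (h (q 0), h (q 1), h (q 2))); rewrite tv.
  by move=> [|[|[|[|//]]]] k4 // _; rewrite /zsum4 qE.
Qed.

Definition weight_index := (wI0 * K + wI1 * (W * W * W) + 'I_m * F)%type.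

(** A master block through [o] becomes a candelabra system over its three other points, any other
    master block becomes the zero-sum quadruples over its four points, and each group with the stem
    is filled by a small system. *)
Definition weight_block (b : weight_index) : {set T} :=
  match b with
  | inl (inl (i, k)) => lift0 i @: c k
  | inl (inr (i, a)) => [set inr (n1 i p, zsum4 a p) | p : 'I_4]
  | inr (x, k) => lift2 x @: f k
  end.

Definition wcov (x y z : T) := exists i, [&& x \in weight_block i, y \in weight_block i & z \in weight_block i].

Lemma wcov_fill x (a b d : 'I_s + W) : a != b -> a != d -> b != d ->
  wcov (lift2 x a) (lift2 x b) (lift2 x d).
Proof.
have [_ fc _] := df => ab ad bd; have [k /and3P[h1 h2 h3]] := fc _ _ _ ab ad bd.
by exists (inr (x, k)); rewrite /weight_block !imset_f.
Qed.

Lemma wcov_cand i (a b d : 'I_s + 'I_3 * W) : lift0 i a != lift0 i b -> lift0 i a != lift0 i d ->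
  lift0 i b != lift0 i d -> mixed b d -> wcov (lift0 i a) (lift0 i b) (lift0 i d).
Proof.
have [_ cv] := cc => ab ad bd M; have [|||k /and3P[h1 h2 h3]] := cv a b d _ _ _ M.
- by apply: contraNneq ab => ->.
- by apply: contraNneq ad => ->.
- by apply: contraNneq bd => ->.
by exists (inl (inl (i, k))); rewrite /weight_block !imset_f.
Qed.

(* Two different master points, the third point in one of their groups, in the stem, or
   in the third group of the master block through [o]. *)
Lemma wcov_two (t : T) x a y b (i : wI0) : inr x \in val i -> inr y \in val i ->
  (if t is inr (z, d) then inr z \in val i else true) -> x != y ->
  t != inr (x, a) -> t != inr (y, b) -> wcov t (inr (x, a)) (inr (y, b)).
Proof.
move=> /n0_onto[p px] /n0_onto[q qy] ti xy tx ty.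
have [t' te] : exists t', lift0 i t' = t.
  case: t ti {tx ty} => [l|[z d]] => [_|/n0_onto[r rz]]; first by exists (inl l).
  by exists (inr (r, d)); rewrite /= rz.
have ex : inr (x, a) = lift0 i (inr (p, a)) by rewrite /= px.
have ey : inr (y, b) = lift0 i (inr (q, b)) by rewrite /= qy.
rewrite ex ey -te in tx ty *; apply: wcov_cand => //.
  by rewrite /= px qy; apply: contraNneq xy => -[->].
by rewrite /mixed /=; apply: contraNneq xy => pq; rewrite -px pq qy.
Qed.

Lemma pair_block x y : x != y -> exists i : wI0, inr x \in val i /\ inr y \in val i.
Proof.
move=> xy; have [||| b bB /and3P[bo bx by']] := @sqs_cover _ _ sB o (inr x) (inr y) => //.
have bI : b \in [set b in B | o \in b] by rewrite inE bB.
by exists (exist _ b bI).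
Qed.

Lemma cube_points (i : wI1) (t : 'I_4) (h : 'I_4 -> W) : exists e, forall p, p != t ->
  inr (n1 i p, h p) \in weight_block (inl (inr (i, e))).
Proof.
have [e he] := zsum4_ex h t; exists e => p /he <-.
by apply/imsetP; exists p.
Qed.

Lemma wcov_three (i : wI1) x y z a b d : inr x \in val i -> inr y \in val i -> inr z \in val i ->
  x != y -> x != z -> y != z -> wcov (inr (x, a)) (inr (y, b)) (inr (z, d)).
Proof.
move=> /n1_onto[p px] /n1_onto[q qy] /n1_onto[r rz] xy xz yz.
have pq : p != q by apply: contraNneq xy => e; rewrite -px -qy e.
have pr : p != r by apply: contraNneq xz => e; rewrite -px -rz e.
have qr : q != r by apply: contraNneq yz => e; rewrite -qy -rz e.
have [t] : exists t, t \in ~: [set p; q; r].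
  by apply/card_gt0P; rewrite cardsCs setCK card_ord cards3.
rewrite !inE !negb_or => /andP[/andP[tp tq] tr].
have [e he] := cube_points i t (fun u => if u == p then a else if u == q then b else d).
have := he r; have := he q; have := he p.
rewrite !eqxx [q == p]eq_sym (negbTE pq) [r == p]eq_sym (negbTE pr) [r == q]eq_sym (negbTE qr).
rewrite px qy rz ![_ == t]eq_sym => h1 h2 h3; exists (inl (inr (i, e))).
by rewrite h1 ?h2 ?h3.
Qed.

Lemma wcov_perm1 x y z : wcov x y z -> wcov y x z.
Proof. by case=> i /and3P[a b d]; exists i; rewrite a b d. Qed.

Lemma weight_covers : covers weight_block.
Proof.
pose rank (x : T) := match x with inl _ => 0 | inr (a, _) => (val a).+1 end.
have N (x y : 'I_m) (a b : W) : inr (x, a) != inr (y, b) :> T -> x = y -> a != b.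
  by move=> h e; apply: contraNneq h => ->; rewrite e.
apply: (@covers_sorted _ _ _ rank) => -[l|[x a]] [l'|[y b]] [l''|[z d]]; rewrite /rank /= => xy xz yz le; try by lia.
- exact: (@wcov_fill (Ordinal m0) (inl l) (inl l') (inl l'')).
- exact: (@wcov_fill z (inl l) (inl l') (inr d)).
- case: (altP (y =P z)) => [e|ne].
    by rewrite -e in yz *; apply: (@wcov_fill y (inl l) (inr b) (inr d)) => //; apply: N yz _.
  by have [i [yi zi]] := pair_block ne; apply: (wcov_two yi zi).
have fill3 : x = y -> y = z -> wcov (inr (x, a)) (inr (y, b)) (inr (z, d)).
  move=> e1 e2; have ab := N _ _ _ _ xy e1; have bd := N _ _ _ _ yz e2.
  have ad := N _ _ _ _ xz (etrans e1 e2).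
  by rewrite e1 e2; apply: (@wcov_fill z (inr a) (inr b) (inr d)).
case: (altP (x =P z)) => [e|xz'].
  have e1 : x = y by apply: ord_inj; move: le; rewrite e /=; lia.
  by apply: fill3; rewrite -?e1.
have [i [xi zi]] := pair_block xz'.
case: (altP (x =P y)) => [e|xy'].
  apply: wcov_perm1; apply: (wcov_two xi zi) => //; first by rewrite -e.
  by rewrite eq_sym.
case: (altP (y =P z)) => [e|yz'].
  apply: wcov_perm1; apply: (wcov_two xi zi) => //; first by rewrite e.
  by rewrite eq_sym.
have [||| g gB /and3P[gx gy gz]] := @sqs_cover _ _ sB (inr x) (inr y) (inr z) => //.
case: (boolP (o \in g)) => og.
  have gI : g \in [set b in B | o \in b] by rewrite inE gB.
  exact: (@wcov_two _ y b z d (exist _ g gI)).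
have gI : g \in [set b in B | o \notin b] by rewrite inE gB.
exact: (@wcov_three (exist _ g gI)).
Qed.

Hypothesis Fn : 24 * #|F| = (s + w'.+1) * (s + w'.+1).-1 * (s + w'.+1).-2.
(** The bounds are a quarter of the number of triples to be covered: 27 = (120 - 3 * 4) / 4 on 10
    points and 1836 = (8436 - 3 * 364) / 4 on 38 points. *)
Hypothesis swK : [&& s == 1, w' == 2 & #|K| <= 27] || [&& s == 2, w' == 11 & #|K| <= 1836].

Lemma weight_design : design weight_block.
Proof.
split; last 2 first.
- exact: weight_covers.
- rewrite !card_sum !card_prod !card_ord !card_sig.
  have -> : #|[pred b | b \in [set b in B | o \in b]]| = #|[set b in B | o \in b]| by apply: eq_card.
  have -> : #|[pred b | b \in [set b in B | o \notin b]]| = #|[set b in B | o \notin b]| by apply: eq_card.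
  have cB := sqs_card sB; have cT := sqs_through o sB.
  rewrite card_sum card_unit card_ord add1n /= in cB cT.
  have := cardsID [set b : {set unit + 'I_m} | o \in b] B.
  have -> : B :&: [set b : {set unit + 'I_m} | o \in b] = [set b in B | o \in b].
    by apply/setP=> b; rewrite !inE.
  have -> : B :\: [set b : {set unit + 'I_m} | o \in b] = [set b in B | o \notin b].
    by apply/setP=> b; rewrite !inE andbC.
  move: #|B| #|[set b in B | o \in b]| #|[set b in B | o \notin b]| cB cT => nB n_0 n_1 cB cT cS.
  move: #|K| #|F| swK Fn => nK nF h hF.
  case: (m) m0 cB cT => [//|n] _ /= cB cT.
  case/orP: h => /and3P[/eqP es /eqP ew hK]; rewrite es ew /= in hF *.
    have {}hF : nF = 1 by lia.
    have hK' : n_0 * nK <= n_0 * 27 by rewrite leq_mul2l hK orbT.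
    rewrite hF; apply: (@leq_trans (24 * (n_0 * 27 + n_1 * 27 + n.+1))); first by lia.
    lia.
  have {}hF : nF = 91 by lia.
  have hK' : n_0 * nK <= n_0 * 1836 by rewrite leq_mul2l hK orbT.
  rewrite hF; apply: (@leq_trans (24 * (n_0 * 1836 + n_1 * 1728 + n.+1 * 91))); first by lia.
  lia.
- move=> [[[i k]|[i e]]|[x k]]; rewrite /weight_block.
  + by apply: leq_trans (leq_imset_card _ _) _; case: cc.
  + by apply: leq_trans (leq_imset_card _ _) _; rewrite card_ord.
  + by apply: leq_trans (leq_imset_card _ _) _; case: df.
Qed.
End Weight.

Lemma pointed (n : nat) (o : 'I_n) : exists (e : 'I_n -> unit + 'I_n.-1) e',
  [/\ cancel e e', cancel e' e & e o = inl tt].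
Proof.
have [||e [e' [eK e'K eo]]] := @bij_split _ unit 'I_n.-1 [set o].
- by rewrite cards1 card_unit.
- by rewrite cardsC1 !card_ord.
exists e, e'; split=> //.
by have [|[]] := eo o; rewrite ?inE.
Qed.

Lemma sqs_image (T T' : finType) (B : {set {set T}}) (e : T -> T') : bijective e ->
  is_sqs B -> is_sqs [set e @: (b : {set T}) | b : {set T} in B].
Proof.
move=> be sB; have [d dK eK] := be.
have -> : [set e @: (b : {set T}) | b : {set T} in B] = [set e @: val i | i : {b | b \in B}].
  apply/setP=> c; apply/imsetP/imsetP => [[b bB ->]|[i _ ->]]; last by exists (val i) => //; apply: valP.
  by exists (exist _ b bB).
have : design (fun i : {b | b \in B} => e @: val i).
  apply: design_transport be _; split=> [i|x y z xy xz yz|].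
  - by rewrite (sqs_card4 sB (valP i)).
  - by have [b bB h] := sqs_cover sB xy xz yz; exists (exist _ b bB).
  - by rewrite card_sig (eq_card (B := B)) // (sqs_card sB).
by case=> v4 vc vn; apply: family_sqs.
Qed.

Section WeightUse.
Variables (s w' : nat) (K : finType) (c : K -> {set 'I_s + 'I_3 * 'I_w'.+1}).
Hypotheses (cc : candelabra c) (sw : sqs (s + w'.+1)).
Hypothesis swK : [&& s == 1, w' == 2 & #|K| <= 27] || [&& s == 2, w' == 11 & #|K| <= 1836].

Lemma sqs_weight u : 1 < u -> sqs u -> sqs (s + u.-1 * w'.+1).
Proof.
move=> u1 [B sB]; have o : 'I_u := Ordinal (ltnW u1).
have [e [e' [eK e'K eo]]] := pointed o.
have sB' := sqs_image (Bijective eK e'K) sB.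
have : sqs #|{: 'I_s + 'I_w'.+1}| by rewrite card_sum !card_ord.
case/sqs_design_on => F [f [df Fn _]]; rewrite card_sum !card_ord in Fn.
have m0 : 0 < u.-1 by lia.
apply: (design_sqs (weight_design cc df m0 sB' Fn swK)).
by rewrite card_sum card_prod !card_ord.
Qed.

(** The transversal blocks avoid the outside point [o], so each of them becomes a family of zero-sum
    quadruples: the new cube is the product of the old one with that of the cyclic group. A stem
    point serves as the new outside point. *)
Lemma flex_weight u k : 1 < u -> flex u k -> flex (s + u.-1 * w'.+1) (k * w'.+1).
Proof.
move=> u1 [B [h [o [sB hi ho hB]]]]; have m0 : 0 < u.-1 by lia.
have [e [e' [eK e'K eo]]] := pointed o; have ei := can_inj eK.
have sB' := sqs_image (Bijective eK e'K) sB; set B' := imset _ _ in sB'.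
have : sqs #|{: 'I_s + 'I_w'.+1}| by rewrite card_sum !card_ord.
case/sqs_design_on => F [f [df Fn _]]; rewrite card_sum !card_ord in Fn.
(* No [h p] is the outside point, so the default value is never taken. *)
pose g p := if e (h p) is inr x then x else Ordinal m0.
have gE p : e (h p) = inr (g p).
  rewrite /g; case E : (e (h p)) => [[]|x] //.
  by have := ho p; rewrite -(inj_eq ei) E eo.
have gi : injective g by move=> p q pq; apply/hi/ei; rewrite !gE pq.
pose F_ j (x : 'I_k * 'I_w'.+1) : 'I_s + 'I_u.-1 * 'I_w'.+1 := inr (g (inord j, x.1), x.2).
have Fi j : injective (F_ j) by move=> [x a] [y b] [/gi [->] ->].
have Fd i j x y : i < 4 -> j < 4 -> i != j -> F_ i x != F_ j y.
  move=> i4 j4; apply: contraNneq => -[/gi [/(congr1 val)]] /=.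
  by rewrite !inordK // => ->.
have s0 : 0 < s by case/orP: swK => /andP[/eqP-> _].
apply: (@four_flex _ _ _ _ (F_ 0) (F_ 1) (F_ 2) (F_ 3) (inl (Ordinal s0)) _ _ (weight_design cc df m0 sB' Fn swK)).
- by rewrite card_sum card_prod !card_ord.
- by rewrite card_prod !card_ord.
- by split; apply: Fi.
- by move=> x y; rewrite !Fd.
- by [].
move=> [x0 a0] [x1 a1] [x2 a2]; have [x3 qB] := hB x0 x1 x2.
pose G j x := g (inord j, x).
have qB' : quad (inr (G 0 x0)) (inr (G 1 x1)) (inr (G 2 x2)) (inr (G 3 x3)) \in B'.
  apply/imsetP; exists (quad (h (inord 0, x0)) (h (inord 1, x1)) (h (inord 2, x2)) (h (inord 3, x3))) => //.
  by rewrite /quad !imsetU !imset_set1 !gE.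
have qI : quad (inr (G 0 x0)) (inr (G 1 x1)) (inr (G 2 x2)) (inr (G 3 x3)) \in
    [set b in B' | inl tt \notin b] by rewrite inE qB' in_quad.
pose i : wI1 B' := exist (fun b => b \in [set b in B' | inl tt \notin b]) _ qI.
have [p0 e0] : exists p, n1 sB' i p = G 0 x0 by apply: n1_onto; rewrite in_quad eqxx.
have [p1 e1] : exists p, n1 sB' i p = G 1 x1 by apply: n1_onto; rewrite in_quad eqxx ?orbT.
have [p2 e2] : exists p, n1 sB' i p = G 2 x2 by apply: n1_onto; rewrite in_quad eqxx ?orbT.
have [p3 e3] : exists p, n1 sB' i p = G 3 x3 by apply: n1_onto; rewrite in_quad eqxx ?orbT.
have Gd j j' x y : j < 4 -> j' < 4 -> j != j' -> G j x != G j' y.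
  move=> j4 j4'; apply: contraNneq => /gi [/(congr1 val)] /=.
  by rewrite !inordK // => ->.
have pd j j' x y p q : j < 4 -> j' < 4 -> j != j' -> n1 sB' i p = G j x -> n1 sB' i q = G j' y -> p != q.
  by move=> j4 j4' jj ep eq; have := Gd j j' x y j4 j4' jj; rewrite -ep -eq; apply: contraNneq => ->.
have d01 : p0 != p1 by apply: pd e0 e1.
have d02 : p0 != p2 by apply: pd e0 e2.
have d12 : p1 != p2 by apply: pd e1 e2.
have d03 : p0 != p3 by apply: pd e0 e3.
have d13 : p1 != p3 by apply: pd e1 e3.
have d23 : p2 != p3 by apply: pd e2 e3.
have [ee hee] := cube_points c f sB' i p3 (fun p => if p == p0 then a0 else if p == p1 then a1 else a2).
exists (x3, zsum4 ee p3), (inl (inr (i, ee))); apply/esym/eqP; rewrite eqEcard; apply/andP; split.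
  apply/subsetP=> t; rewrite in_quad => /or4P[] /eqP->; rewrite /F_ /=.
  - by have := hee _ d03; rewrite eqxx e0.
  - by have := hee _ d13; rewrite [p1 == p0]eq_sym (negbTE d01) eqxx e1.
  - by have := hee _ d23; rewrite [p2 == p0]eq_sym (negbTE d02) [p2 == p1]eq_sym (negbTE d12) e2.
  - by apply/imsetP; exists p3; rewrite ?e3.
apply: leq_trans (leq_imset_card _ _) _; rewrite card_ord /quad setUC cardsU1 cards3 ?Fd //.
by rewrite !inE !negb_or !Fd.
Qed.
End WeightUse.

(** * Orders 3u - 2 and 12u - 10 *)

(* Points are coded by numbers: [w i + x] is the point [x] of the group [i], the codes from
   [3 w] on are the stem. The translation [t] also acts on the stem, modulo [s]. *)
Definition code_act (w s r t p : nat) : nat :=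
  if p < 3 * w then w * ((p %/ w + r) %% 3) + (p %% w + t) %% w else 3 * w + (p - 3 * w + t) %% s.

Definition code_orbits (w s rr tt : nat) (L : seq (seq nat)) : seq (seq nat) :=
  flatten [seq flatten [seq [seq [seq code_act w s r t p | p <- b] | t <- iota 0 tt] | r <- iota 0 rr] | b <- L].

(** The blocks are filtered point by point, so that a triple is searched for only among the blocks
    through its first two points. *)
Definition code_check (N : nat) (skip : nat -> nat -> nat -> bool) (L : seq (seq nat)) : bool :=
  all (fun a => let La := filter (fun b => a \in b) L in
  all (fun b => let Lb := filter (fun d => b \in d) La in
  all (fun c => has (fun d => c \in d) Lb || skip a b c)
  (iota b.+1 (N - b.+1))) (iota a.+1 (N - a.+1))) (iota 0 N).

Section Coded.
Variables (T : finType) (enc : T -> nat) (N : nat) (skip : nat -> nat -> nat -> bool) (L : seq (seq nat)).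
Hypotheses (encI : injective enc) (encN : forall x, enc x < N).
Hypotheses (sk1 : forall a b c, skip a b c = skip b a c) (sk2 : forall a b c, skip a b c = skip a c b).
Hypothesis chk : code_check N skip L.

Definition coded_block (k : 'I_(size L)) : {set T} := [set x | enc x \in nth [::] L k].

Lemma coded_cover x y z : x != y -> x != z -> y != z -> ~~ skip (enc x) (enc y) (enc z) ->
  exists k, [&& x \in coded_block k, y \in coded_block k & z \in coded_block k].
Proof.
move: x y z; apply: (@sorted3_wlog T enc) => [x y z H|x y z H|x y z /andP[rs1 rs2]] xy xz yz sk.
- have [||||k /and3P[a b c]] := H; rewrite // 1?eq_sym // 1?sk1 //.
  by exists k; rewrite a b c.
- have [||||k /and3P[a b c]] := H; rewrite // 1?eq_sym // 1?sk2 //.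
  by exists k; rewrite a b c.
have l1 : enc x < enc y by rewrite ltn_neqAle rs1 (inj_eq encI) xy.
have l2 : enc y < enc z by rewrite ltn_neqAle rs2 (inj_eq encI) yz.
have ny := encN y; have nz := encN z.
move/allP/(_ (enc x)): chk; rewrite mem_iota encN => /(_ isT)/allP/(_ (enc y)).
rewrite mem_iota l1 subnKC ?ny; last by lia.
move=> /(_ isT)/allP/(_ (enc z)); rewrite mem_iota l2 subnKC ?nz; last by lia.
move=> /(_ isT); rewrite (negbTE sk) orbF => /hasP[d].
rewrite !mem_filter => /andP[yd /andP[xd dL]] zd.
have ds : index d L < size L by rewrite index_mem.
by exists (Ordinal ds); rewrite !inE /= nth_index // xd yd zd.
Qed.
Hypothesis L4 : all (fun b => size b <= 4) L.

Lemma card_coded k : #|coded_block k| <= 4.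
Proof.
have b4 : size (nth [::] L k) <= 4 by apply: (allP L4); apply: mem_nth.
apply: leq_trans b4; rewrite cardE -(size_map enc); apply: uniq_leq_size.
  by rewrite (map_inj_uniq encI) enum_uniq.
by move=> _ /mapP[x h ->]; move: h; rewrite mem_enum inE.
Qed.

End Coded.

(** Two copies of Z_7 and 13 base blocks: 13 * 7 = 91 blocks, as many as a system on 14 points
    has. *)
Definition sqs14_blocks := code_orbits 7 1 1 7
  [:: [:: 0; 8; 9; 13]; [:: 7; 8; 9; 11]; [:: 0; 1; 12; 13]; [:: 0; 1; 10; 11]; [:: 0; 1; 7; 8]; [:: 0; 1; 2; 5];
    [:: 0; 1; 3; 9]; [:: 0; 3; 11; 13]; [:: 0; 2; 10; 13]; [:: 0; 3; 8; 12]; [:: 0; 2; 9; 11]; [:: 0; 2; 7; 12];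
    [:: 0; 3; 7; 10]].

Definition cand3_blocks := code_orbits 3 1 1 3
  [:: [:: 0; 5; 8; 9]; [:: 0; 4; 6; 9]; [:: 0; 3; 7; 9]; [:: 0; 1; 7; 8]; [:: 0; 3; 6; 8]; [:: 0; 4; 5; 7];
    [:: 3; 4; 7; 8]; [:: 0; 1; 5; 6]; [:: 0; 1; 3; 4]].

(** Base blocks for Z_3 x Z_12. Those of the last two lists have stabilizers of order 3 and 2, hence
    the shorter orbits: 49 * 36 + 3 * 12 + 2 * 18 = 1836. *)
Definition cand12_blocks :=
  code_orbits 12 2 3 12
  [:: [:: 0; 14; 25; 36]; [:: 0; 19; 28; 36]; [:: 0; 17; 27; 37]; [:: 0; 15; 30; 36]; [:: 0; 12; 31; 37]; [:: 0; 13; 26; 37];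
    [:: 0; 14; 32; 37]; [:: 0; 3; 17; 22]; [:: 0; 5; 19; 29]; [:: 0; 5; 14; 21]; [:: 0; 2; 26; 33]; [:: 0; 2; 15; 22];
    [:: 0; 4; 15; 20]; [:: 0; 3; 26; 31]; [:: 0; 4; 24; 29]; [:: 0; 3; 28; 33]; [:: 0; 5; 24; 30]; [:: 0; 5; 18; 35];
    [:: 0; 3; 19; 34]; [:: 0; 3; 23; 32]; [:: 0; 3; 12; 30]; [:: 0; 3; 15; 21]; [:: 0; 3; 14; 20]; [:: 0; 2; 32; 35];
    [:: 0; 1; 28; 34]; [:: 0; 3; 25; 29]; [:: 0; 1; 13; 16]; [:: 0; 3; 13; 27]; [:: 0; 1; 20; 24]; [:: 0; 4; 16; 33];
    [:: 0; 1; 15; 23]; [:: 0; 4; 12; 35]; [:: 0; 2; 19; 21]; [:: 0; 1; 17; 26]; [:: 0; 1; 18; 32]; [:: 0; 1; 19; 30];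
    [:: 0; 1; 14; 29]; [:: 0; 4; 13; 21]; [:: 0; 4; 19; 32]; [:: 0; 1; 12; 27]; [:: 0; 1; 31; 33]; [:: 0; 1; 22; 25];
    [:: 0; 4; 17; 28]; [:: 0; 2; 13; 23]; [:: 0; 2; 14; 16]; [:: 0; 2; 12; 28]; [:: 0; 4; 18; 22]; [:: 0; 2; 20; 30];
    [:: 0; 1; 21; 35]] ++
  code_orbits 12 2 1 12 [:: [:: 0; 16; 32; 36]; [:: 0; 20; 28; 37]; [:: 0; 12; 24; 36]] ++
  code_orbits 12 2 3 6 [:: [:: 0; 6; 16; 22]; [:: 0; 6; 13; 19]].

Definition same_group (w a b c : nat) : bool :=
  has (fun i => [&& (3 * w <= a) || (a %/ w == i), (3 * w <= b) || (b %/ w == i) & (3 * w <= c) || (c %/ w == i)]) (iota 0 3).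

Lemma same_group1 w a b c : same_group w a b c = same_group w b a c.
Proof. by apply: eq_has => i; rewrite andbCA. Qed.

Lemma same_group2 w a b c : same_group w a b c = same_group w a c b.
Proof. by apply: eq_has => i; rewrite [X in _ && X]andbC. Qed.

Lemma sqs14_check : code_check 14 (fun _ _ _ => false) sqs14_blocks.
Proof. by vm_compute. Qed.

Lemma cand3_check : code_check 10 (same_group 3) cand3_blocks.
Proof. by vm_compute. Qed.

Lemma cand12_check : code_check 38 (same_group 12) cand12_blocks.
Proof. by vm_compute. Qed.

Lemma sqs2 : sqs 2.
Proof.
exists set0; apply/andP; split; first by apply/forall_inP=> b; rewrite inE.
apply/forallP=> A; apply/implyP=> /eqP A3.
by have := max_card (mem A); rewrite card_ord A3.
Qed.

Lemma sqs14 : sqs 14.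
Proof.
have L4 : all (fun b => size b <= 4) sqs14_blocks by [].
apply: (@design_sqs 'I_14 'I_(size sqs14_blocks) (coded_block (@nat_of_ord 14) (L := sqs14_blocks))); last by rewrite card_ord.
split; last by rewrite !card_ord.
- exact: (card_coded (@ord_inj 14) L4).
- move=> x y z xy xz yz.
  have [//|//|k hk] := @coded_cover _ _ 14 (fun _ _ _ => false) _ (@ord_inj 14) (@ltn_ord 14) _ _ sqs14_check _ _ _ xy xz yz isT.
  by exists k.
Qed.

Section CandelabraCode.
Variables (s w : nat) (L : seq (seq nat)).
Hypotheses (chk : code_check (3 * w + s) (same_group w) L) (L4 : all (fun b => size b <= 4) L).

Definition cand_enc (x : 'I_s + 'I_3 * 'I_w) : nat :=
  match x with inl l => 3 * w + l | inr (i, a) => w * i + a end.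

Lemma cand_enc_div i a : cand_enc (inr (i, a)) %/ w = i /\ cand_enc (inr (i, a)) < 3 * w.
Proof.
have aw := ltn_ord a; have i3 := ltn_ord i; rewrite /cand_enc; split.
  by rewrite mulnC divnMDl ?divn_small ?addn0 //; lia.
have : w * i <= w * 2 by rewrite leq_mul2l -ltnS i3 orbT.
by lia.
Qed.

Lemma cand_enc_inj : injective cand_enc.
Proof.
move=> [l|[i a]] [l'|[i' a']].
- by move/addnI/ord_inj->.
- by move=> e; have [_] := cand_enc_div i' a'; rewrite -e ltnNge leq_addr.
- by move=> e; have [_] := cand_enc_div i a; rewrite e ltnNge leq_addr.
- move=> e; have [d _] := cand_enc_div i a; have [d' _] := cand_enc_div i' a'.
  have ii : i = i' by apply: ord_inj; rewrite -d -d' e.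
  by move: e; rewrite ii /cand_enc => /addnI/ord_inj->.
Qed.

Lemma candelabra_code : candelabra (coded_block cand_enc (L := L)).
Proof.
split=> [k|x y z xy xz yz]; first exact: card_coded cand_enc_inj L4 k.
move=> M; apply: (coded_cover cand_enc_inj _ (same_group1 w) (same_group2 w) chk xy xz yz).
  move=> [l|[i a]]; first by rewrite /cand_enc; have := ltn_ord l; lia.
  by have [_ h] := cand_enc_div i a; apply: leq_trans h (leq_addr _ _).
move: M; rewrite /mixed; case: y {xy yz} => [//|[i a]]; case: z {xz} => [//|[j b]] /= ij.
apply/hasPn=> e _; have [d l] := cand_enc_div i a; have [d' l'] := cand_enc_div j b.
have g1 : (3 * w <= cand_enc (inr (i, a))) = false by apply/negbTE; rewrite -ltnNge.
have g2 : (3 * w <= cand_enc (inr (j, b))) = false by apply/negbTE; rewrite -ltnNge.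
rewrite d d' g1 g2 /= negb_and; apply/orP; right.
by apply: contra ij => /andP[/eqP ie /eqP je]; apply/eqP/ord_inj; rewrite ie je.
Qed.
End CandelabraCode.

Lemma sqs_3u2 u : 1 < u -> sqs u -> sqs (1 + u.-1 * 3).
Proof.
have L4 : all (fun b => size b <= 4) cand3_blocks by [].
apply: (sqs_weight (@candelabra_code 1 3 cand3_blocks cand3_check L4) (sqs_double sqs2 isT isT)).
by rewrite card_ord.
Qed.

Lemma flex_3u2 u k : 1 < u -> flex u k -> flex (1 + u.-1 * 3) (k * 3).
Proof.
have L4 : all (fun b => size b <= 4) cand3_blocks by [].
apply: (flex_weight (@candelabra_code 1 3 cand3_blocks cand3_check L4) (sqs_double sqs2 isT isT)).
by rewrite card_ord.
Qed.

Lemma cand12_size : size cand12_blocks = 1836.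
Proof. by vm_compute. Qed.

Lemma cand12_4 : all (fun b => size b <= 4) cand12_blocks.
Proof. by vm_compute. Qed.

Lemma sqs_12u10 u : 1 < u -> sqs u -> sqs (2 + u.-1 * 12).
Proof.
apply: (sqs_weight (@candelabra_code 2 12 cand12_blocks cand12_check cand12_4) sqs14).
by rewrite card_ord cand12_size.
Qed.

Lemma flex_12u10 u k : 1 < u -> flex u k -> flex (2 + u.-1 * 12) (k * 12).
Proof.
apply: (flex_weight (@candelabra_code 2 12 cand12_blocks cand12_check cand12_4) sqs14).
by rewrite card_ord cand12_size.
Qed.

(** * Counting Latin cubes and quadruple systems *)

Lemma card_bigcup_le (I T : finType) (P : pred I) (F : I -> {set T}) :
  #|\bigcup_(i | P i) F i| <= \sum_(i | P i) #|F i|.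
Proof.
elim/big_rec2: _ => [|i n A _ h]; first by rewrite cards0.
by rewrite cardsU; apply: leq_trans (leq_subr _ _) _; rewrite leq_add2l.
Qed.

(* Perturbations [x + y + z + e(x, y, z)] of a group cube by elements [d] of exponent 2: the
   closure condition makes the support of [e] a disjoint union of cosets
   [c + {0, d}^3] on which [e = d], and every such [e] gives a Latin cube. *)
Section Perturbations.
Variables (a b : nat).
Notation V := {ffun 'I_a -> 'I_2}.
Notation M := 'I_b.+1.
Notation H := (V * M)%type.
Notation X := (H * H * H)%type.
Open Scope ring_scope.

Lemma addVV (d : V) : d + d = 0.
Proof. by apply/ffunP=> i; rewrite !ffunE; apply: val_inj; case: (d i) => [[|[|]]]. Qed.

Definition sh (d : V) (u : bool) (x : H) : H := (x.1 + (if u then d else 0), x.2).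

Definition act (d : V) (u : bool * bool * bool) (c : X) : X :=
  (sh d u.1.1 c.1.1, sh d u.1.2 c.1.2, sh d u.2 c.2).

Definition coset (d : V) (c : X) : {set X} := [set act d u c | u : bool * bool * bool].

Lemma shsh d u u' x : sh d u' (sh d u x) = sh d (u (+) u') x.
Proof.
rewrite /sh /= -addrA; congr (_ + _, _).
by case: u; case: u'; rewrite ?addVV ?addr0 ?add0r.
Qed.

Lemma actact d u u' c : act d u' (act d u c) = act d (u.1.1 (+) u'.1.1, u.1.2 (+) u'.1.2, u.2 (+) u'.2) c.
Proof. by rewrite /act /= !shsh. Qed.

Lemma act0 u c : act 0 u c = c.
Proof.
by case: c => [[[x1 x2] [y1 y2]] [z1 z2]]; rewrite /act /sh /= !if_same !addr0.
Qed.

Lemma act_coset d u c s : s \in coset d c -> act d u s \in coset d c.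
Proof. by case/imsetP=> u' _ ->; rewrite actact; apply: imset_f. Qed.

Lemma coset_refl d c : c \in coset d c.
Proof.
apply/imsetP; exists (false, false, false) => //.
by case: c => [[[x1 x2] [y1 y2]] [z1 z2]]; rewrite /act /sh /= !addr0.
Qed.

Lemma coset_sym d c s : s \in coset d c -> c \in coset d s.
Proof.
case/imsetP=> u _ ->; apply/imsetP; exists u => //; rewrite actact !addbb.
by case: c => [[[x1 x2] [y1 y2]] [z1 z2]]; rewrite /act /sh /= !addr0.
Qed.

Lemma card_coset d c : (#|coset d c| <= 8)%N.
Proof.
by apply: leq_trans (leq_imset_card _ _) _; rewrite !card_prod card_bool.
Qed.

Definition closed_pert (e : {ffun X -> V}) : bool :=
  [forall c, forall u, e (act (e c) u c) == e c].

Definition supp (e : {ffun X -> V}) : {set X} := [set c | e c != 0].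

Definition pert_le (m : nat) : {set {ffun X -> V}} := [set e | closed_pert e & (#|supp e| <= 8 * m)%N].

Definition free (e : {ffun X -> V}) (t : V * X) : bool :=
  (t.1 != 0) && [disjoint coset t.1 t.2 & supp e].

Definition insert_coset (e : {ffun X -> V}) (t : V * X) : {ffun X -> V} :=
  [ffun s => if s \in coset t.1 t.2 then t.1 else e s].

Lemma insert_closed e t : closed_pert e -> free e t -> closed_pert (insert_coset e t).
Proof.
case: t => d c ce /andP[/= d0 dis]; apply/forallP=> s; apply/forallP=> u; rewrite !ffunE /=.
case: (boolP (s \in coset d c)) => sc; first by rewrite act_coset.
have /eqP ecl := forallP (forallP ce s) u.
case: (altP (e s =P 0)) => [e0|en]; first by rewrite e0 act0 (negbTE sc) e0.
rewrite ifN ?ecl //; apply/negP => h.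
by have := disjointFr dis h; rewrite inE ecl en.
Qed.

Lemma insert_supp e t : (#|supp (insert_coset e t)| <= 8 + #|supp e|)%N.
Proof.
apply: leq_trans (_ : (#|coset t.1 t.2 :|: supp e| <= _)%N).
  by apply: subset_leq_card; apply/subsetP=> s; rewrite !inE ffunE; case: ifP => //= ->.
by rewrite cardsU; apply: leq_trans (leq_subr _ _) _; rewrite leq_add2r card_coset.
Qed.

(* The new coset and the old perturbation are recovered from one point of the coset. *)
Lemma insert_inj : {in [pred p : {ffun X -> V} * (V * X) | free p.1 p.2] &,
  injective (fun p => (insert_coset p.1 p.2, p.2.2))}.
Proof.
move=> [e [d c]] [e' [d' c']]; rewrite !inE /free /= => /andP[d0 dis] /andP[d0' dis'] [].
move=> ie cc; subst c'.
have dd : d = d'.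
  by have := congr1 (fun f : {ffun X -> V} => f c) ie; rewrite !ffunE /= !coset_refl.
subst d'; congr (_, _); apply/ffunP=> s.
have := congr1 (fun f : {ffun X -> V} => f s) ie; rewrite !ffunE /=.
case: ifP => // sc _; have := disjointFr dis sc; have := disjointFr dis' sc.
by rewrite !inE => /negbFE/eqP-> /negbFE/eqP->.
Qed.

Lemma card_X : #|{: X}| = ((2 ^ a * b.+1) ^ 3)%N.
Proof.
rewrite !card_prod card_ffun !card_ord; move: (2 ^ a * b.+1)%N => x.
by rewrite !expnS expn0 muln1 mulnA.
Qed.

Lemma card_nz : #|[set d : V | d != 0]| = (2 ^ a).-1.
Proof.
have := cardsC1 (0 : V); rewrite card_ffun !card_ord => <-.
by apply: eq_card => d; rewrite !inE.
Qed.

(** Each of the at most [8 * m] points of the support rules out, for each [d], the at most 8 base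
    points of its own coset. *)
Lemma card_free m e : e \in pert_le m ->
  ((2 ^ a).-1 * (#|{: X}| - 64 * m) <= #|[set t | free e t]|)%N.
Proof.
rewrite inE => /andP[ce em]; set D := (2 ^ a).-1.
pose all_t := [set t : V * X | t.1 != 0].
have ca : #|all_t| = (D * #|{: X}|)%N.
  rewrite /D -card_nz -cardsT -cardsX; apply: eq_card => t.
  by rewrite !inE andbT.
pose bad := \bigcup_(s in supp e) \bigcup_(d : V | d != 0) [set (d, c) | c in coset d s].
have cb : (#|bad| <= 64 * m * D)%N.
  apply: leq_trans (_ : (\sum_(s in supp e) 8 * D <= _)%N); last first.
    by rewrite sum_nat_const; apply: leq_trans (leq_mul em (leqnn (8 * D)%N)) _; lia.
  rewrite /bad; apply: leq_trans (card_bigcup_le _ _) _.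
  apply: leq_sum => s _; apply: leq_trans (card_bigcup_le _ _) _.
  rewrite mulnC /D -card_nz -sum1dep_card big_distrl /=.
  apply: leq_sum => d _; rewrite mul1n; apply: leq_trans (leq_imset_card _ _) _; exact: card_coset.
have sub : all_t :\: bad \subset [set t | free e t].
  apply/subsetP=> -[d c]; rewrite !inE /free /= => /andP[nb d0]; rewrite d0 /=.
  apply/pred0P=> s /=; apply/negbTE; apply: contra nb => /andP[sc se].
  apply/bigcupP; exists s => //; apply/bigcupP; exists d => //.
  by apply/imsetP; exists c => //; apply: coset_sym.
apply: leq_trans (subset_leq_card sub); rewrite cardsD ca.
have h : (#|all_t :&: bad| <= #|bad|)%N by rewrite subset_leq_card // subsetIr.
rewrite mulnBr; apply: leq_sub2l; apply: leq_trans h _; apply: leq_trans cb _.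
by rewrite mulnC.
Qed.

(** Double counting of insertions: by [insert_inj] each is determined by the new perturbation and a
    point of its support, for which there are at most [8 * m.+1] choices. *)
Lemma pert_step m : (#|pert_le m| * ((2 ^ a).-1 * (#|{: X}| - 64 * m)) <= #|pert_le m.+1| * (8 * m.+1))%N.
Proof.
pose Src := [set p : {ffun X -> V} * (V * X) | (p.1 \in pert_le m) && free p.1 p.2].
pose Dst := [set p : {ffun X -> V} * X | (p.1 \in pert_le m.+1) && (p.2 \in supp p.1)].
have h1 : (#|pert_le m| * ((2 ^ a).-1 * (#|{: X}| - 64 * m)) <= #|Src|)%N.
  rewrite -sum_nat_const; apply: leq_trans (_ : (\sum_(e in pert_le m) #|[set t | free e t]| <= _)%N).
    by apply: leq_sum => e; apply: card_free.
  rewrite -sum1dep_card (eq_bigr (fun e => \sum_(t | free e t) 1)%N) => [|e _]; last by rewrite sum1dep_card.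
  by rewrite pair_big_dep /=.
have h2 : (#|Dst| <= #|pert_le m.+1| * (8 * m.+1))%N.
  rewrite -[X in (_ <= X)%N]sum_nat_const; apply: leq_trans (_ : (\sum_(e in pert_le m.+1) #|supp e| <= _)%N).
    rewrite -sum1dep_card (eq_bigr (fun e => \sum_(t in supp e) 1)%N) => [|e _]; last by rewrite sum1_card.
    by rewrite pair_big_dep /=.
  by apply: leq_sum => e; rewrite inE => /andP[].
apply: leq_trans h1 _; apply: leq_trans _ h2.
rewrite -(card_in_imset (f := fun p : {ffun X -> V} * (V * X) => (insert_coset p.1 p.2, p.2.2)) (D := mem Src)); last first.
  by move=> p q; rewrite !inE => /andP[_ fp] /andP[_ fq]; apply: insert_inj.
apply: subset_leq_card; apply/subsetP=> _ /imsetP[[e [d c]] h ->]; move: h; rewrite !inE /= => /andP[/andP[ce em] fe].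
rewrite insert_closed //= ffunE coset_refl /=; case/andP: (fe) => /= -> _; rewrite andbT.
by apply: leq_trans (insert_supp _ _) _; rewrite /= mulnS leq_add2l.
Qed.

(** While [128 * m.+1 <= #|X|], at least half of the base points remain available for each nonzero
    [d], and this outweighs the overcount [8 * m.+1] so far that each step gains a factor
    [2 ^ a]. *)
Lemma pert_many (m : nat) : (0 < a)%N -> (128 * m <= #|{: X}|)%N -> ((2 ^ a) ^ m <= #|pert_le m|)%N.
Proof.
move=> a0; elim: m => [_|m IH mX].
  rewrite expn0; apply/card_gt0P; exists 0; rewrite !inE; apply/andP; split.
    by apply/forallP=> c; apply/forallP=> u; rewrite !ffunE.
  by rewrite leqn0 cards_eq0; apply/eqP/setP=> c; rewrite !inE ffunE eqxx.
have {}IH := IH (leq_trans (leq_mul (leqnn 128) (leqnSn m)) mX).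
have st := pert_step m.
have d1 : (2 ^ a <= 2 * (2 ^ a).-1)%N.
  have : (2 <= 2 ^ a)%N by rewrite -{1}(expn1 2) leq_exp2l.
  lia.
set D := (2 ^ a).-1 in st d1; set q := (2 ^ a)%N in IH d1 *.
rewrite expnS -(@leq_pmul2r (8 * m.+1)) ; last by lia.
apply: leq_trans st; apply: leq_trans (_ : (q ^ m * (q * (8 * m.+1)) <= _)%N); first by lia.
apply: leq_mul => //; apply: leq_trans (_ : (D * (16 * m.+1) <= _)%N); last first.
  by rewrite leq_mul2l; apply/orP; right; lia.
apply: leq_trans (_ : (2 * D * (8 * m.+1) <= _)%N); first by rewrite leq_mul2r d1 orbT.
lia.
Qed.

Definition cube (e : {ffun X -> V}) (x y z : H) : H :=
  (x.1 + y.1 + z.1 + e (x, y, z), x.2 + y.2 + z.2).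

(** A closed perturbation is constant under shifts by its own value. Two arguments giving the same
    value on a line of the cube are shifted to one common point, hence have the same perturbation;
    this makes [cube] Latin. *)
Lemma pert_inj e c c' u : closed_pert e -> act (e c) u c = act (e c') u c' -> e c = e c'.
Proof.
move=> ce h; have cl d v := eqP (forallP (forallP ce d) v).
by rewrite -(cl c u) h cl.
Qed.

Lemma cube_inj1 e y z : closed_pert e -> injective (fun x => cube e x y z).
Proof.
move=> ce x x' E; have h1 := congr1 fst E; have h2 := congr1 snd E; rewrite /cube /= in h1 h2.
have {}h2 : x.2 = x'.2 by apply: (addIr y.2); apply: (addIr z.2).
have xx : x.1 + e (x, y, z) = x'.1 + e (x', y, z).
  by apply: (addIr (y.1 + z.1)); rewrite ![_ + e _ + _]addrAC !addrA.
have ee : e (x, y, z) = e (x', y, z).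
  by apply: (pert_inj (u := (true, false, false))) => //; rewrite /act /sh /= xx h2.
move: xx; rewrite ee => /addIr h3.
by rewrite [x]surjective_pairing h3 h2 -surjective_pairing.
Qed.

Lemma cube_inj2 e x z : closed_pert e -> injective (fun y => cube e x y z).
Proof.
move=> ce y y' E; have h1 := congr1 fst E; have h2 := congr1 snd E; rewrite /cube /= in h1 h2.
have {}h2 : y.2 = y'.2 by apply: (addrI x.2); apply: (addIr z.2).
have xx : y.1 + e (x, y, z) = y'.1 + e (x, y', z).
  apply: (addrI x.1); apply: (addIr z.1).
  by rewrite !addrA ![_ + e _ + _]addrAC.
have ee : e (x, y, z) = e (x, y', z).
  by apply: (pert_inj (u := (false, true, false))) => //; rewrite /act /sh /= xx h2.
move: xx; rewrite ee => /addIr h3.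
by rewrite [y]surjective_pairing h3 h2 -surjective_pairing.
Qed.

Lemma cube_inj3 e x y : closed_pert e -> injective (fun z => cube e x y z).
Proof.
move=> ce z z' E; have h1 := congr1 fst E; have h2 := congr1 snd E; rewrite /cube /= in h1 h2.
have {}h2 : z.2 = z'.2 by apply: (addrI (x.2 + y.2)).
have xx : z.1 + e (x, y, z) = z'.1 + e (x, y, z').
  by apply: (addrI (x.1 + y.1)); rewrite !addrA.
have ee : e (x, y, z) = e (x, y, z').
  by apply: (pert_inj (u := (false, false, true))) => //; rewrite /act /sh /= xx h2.
move: xx; rewrite ee => /addIr h3.
by rewrite [z]surjective_pairing h3 h2 -surjective_pairing.
Qed.

Lemma cube_pert e e' : (forall x y z, cube e x y z = cube e' x y z) -> e = e'.
Proof.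
move=> h; apply/ffunP=> -[[x y] z]; have /(congr1 fst) := h x y z.
by rewrite /cube /= => /addrI.
Qed.
End Perturbations.

Lemma inj_onto (T : finType) (f : T -> T) : injective f -> forall y, exists x, f x = y.
Proof. by move=> fi y; exists (invF fi y); rewrite f_invF. Qed.

(** * Replacing the Latin cube inside a quadruple system *)

Section Switch.
Variables (n : nat) (H : finType) (B : {set {set 'I_n}}) (F : 'I_4 -> H -> 'I_n).
Hypotheses (sB : is_sqs B) (Fi : forall i j x y, F i x = F j y -> i = j /\ x = y).
Hypothesis FB : forall x y z, exists w,
  quad (F (inord 0) x) (F (inord 1) y) (F (inord 2) z) (F (inord 3) w) \in B.

Definition tquad (x y z w : H) : {set 'I_n} :=
  quad (F (inord 0) x) (F (inord 1) y) (F (inord 2) z) (F (inord 3) w).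

Definition transversal : {set {set 'I_n}} :=
  [set b in B | [exists x, exists y, exists z, exists w, b == tquad x y z w]].

Lemma ord4_neq i j : i < 4 -> j < 4 -> i != j -> (inord i : 'I_4) != inord j.
Proof. by move=> i4 j4; apply: contraNneq => /(congr1 val) /=; rewrite !inordK // => ->. Qed.

Lemma tquad_inj x y z w x' y' z' w' : tquad x y z w = tquad x' y' z' w' ->
  [/\ x = x', y = y', z = z' & w = w'].
Proof.
move=> e; have key i t : i < 4 -> F (inord i) t \in tquad x' y' z' w' ->
    t = match i with 0 => x' | 1 => y' | 2 => z' | _ => w' end.
  move=> i4; rewrite in_quad => /or4P[] /eqP /Fi[/(congr1 val) /=]; rewrite !inordK // => -> ->; done.
split.
- by apply: (key 0 x isT); rewrite -e in_quad eqxx.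
- by apply: (key 1 y isT); rewrite -e in_quad eqxx ?orbT.
- by apply: (key 2 z isT); rewrite -e in_quad eqxx ?orbT.
- by apply: (key 3 w isT); rewrite -e in_quad eqxx ?orbT.
Qed.

Lemma card_transversal : #|{: H * H * H}| <= #|transversal|.
Proof.
have ex (c : H * H * H) : exists w, tquad c.1.1 c.1.2 c.2 w \in B by apply: FB.
pose W c := xchoose (ex c); have WB c := xchooseP (ex c).
pose g (c : H * H * H) := tquad c.1.1 c.1.2 c.2 (W c).
have gi : injective g.
  by move=> [[x y] z] [[x' y'] z'] /tquad_inj /= [-> -> ->].
rewrite -(card_imset _ gi); apply: subset_leq_card; apply/subsetP=> _ /imsetP[c _ ->].
rewrite inE WB /=; apply/existsP; exists c.1.1; apply/existsP; exists c.1.2.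
by apply/existsP; exists c.2; apply/existsP; exists (W c).
Qed.

Variable L : H -> H -> H -> H.
Hypotheses (L1 : forall y z, injective (fun x => L x y z)) (L2 : forall x z, injective (fun y => L x y z))
  (L3 : forall x y, injective (fun z => L x y z)).

Definition switch : {set {set 'I_n}} :=
  (B :\: transversal) :|: [set tquad c.1.1 c.1.2 c.2 (L c.1.1 c.1.2 c.2) | c : H * H * H].

(** Three points of a transversal block miss one of its coordinates, and the Latin property of [L]
    allows that coordinate to be solved anew from the other three. *)
Lemma switch_three x y z w (p q r : 'I_n) : p != q -> p != r -> q != r ->
  p \in tquad x y z w -> q \in tquad x y z w -> r \in tquad x y z w ->
  exists c : H * H * H, let b := tquad c.1.1 c.1.2 c.2 (L c.1.1 c.1.2 c.2) in
    [&& p \in b, q \in b & r \in b].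
Proof.
move=> pq pr qr pb qb rb.
have [x' hx] := inj_onto (@L1 y z) w; have [y' hy] := inj_onto (@L2 x z) w.
have [z' hz] := inj_onto (@L3 x y) w.
pose P4 := fun t => t \in [set p; q; r].
have card4 : #|tquad x y z w| = 4.
  have d i j t u : i < 4 -> j < 4 -> i != j -> F (inord i) t != F (inord j) u.
    by move=> i4 j4 ij; apply: contraNneq (ord4_neq i4 j4 ij) => /Fi[->].
  by rewrite /tquad /quad setUC cardsU1 cards3 ?d // !inE !negb_or !d.
have three : ~~ [&& P4 (F (inord 0) x), P4 (F (inord 1) y), P4 (F (inord 2) z) & P4 (F (inord 3) w)].
  apply/negP => /and4P[h0 h1 h2 h3].
  have : tquad x y z w \subset [set p; q; r].
    by apply/subsetP=> t; rewrite in_quad => /or4P[] /eqP->.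
  by move/subset_leq_card; rewrite cards3 // card4.
have out t : ~~ P4 t -> [/\ (p == t) = false, (q == t) = false & (r == t) = false].
  by rewrite /P4 !inE !negb_or => /andP[/andP[/negbTE tp /negbTE tq] /negbTE tr]; rewrite ![_ == t]eq_sym.
move: three pb qb rb; rewrite !negb_and !in_quad.
case/or4P => /out [-> -> ->]; rewrite /= ?orbF => pb qb rb;
  [exists (x', y, z)|exists (x, y', z)|exists (x, y, z')|exists (x, y, z)];
  rewrite /= !in_quad ?hx ?hy ?hz; apply/and3P; split;
  first [by case/or3P: pb => ->; rewrite ?orbT | by case/or3P: qb => ->; rewrite ?orbT
        | by case/or3P: rb => ->; rewrite ?orbT].
Qed.

(** By [card_transversal] at least as many blocks are removed as are added, so only coverage is at
    stake. *)
Lemma switch_sqs : is_sqs switch.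
Proof.
pose I := ({b | b \in B :\: transversal} + H * H * H)%type.
pose v (i : I) : {set 'I_n} :=
  match i with inl b => val b | inr c => tquad c.1.1 c.1.2 c.2 (L c.1.1 c.1.2 c.2) end.
have -> : switch = [set v i | i : I].
  apply/setP=> b; apply/setUP/imsetP => [[bB|/imsetP[c _ ->]]|[[[b' b'B]|c] _ ->]] /=.
  - by exists (inl (exist _ b bB)).
  - by exists (inr c).
  - by left.
  - by right; apply: imset_f.
apply: family_sqs => [[[b bB]|c]||] /=.
- by move: bB; rewrite inE => /andP[_ /(sqs_card4 sB) ->].
- exact: card_quad_le.
- move=> p q r pq pr qr; have [b bB /and3P[bp bq br]] := sqs_cover sB pq pr qr.
  case: (boolP (b \in transversal)) => bT.
    move: bT; rewrite inE bB /= => /existsP[x /existsP[y /existsP[z /existsP[w /eqP be]]]].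
    rewrite be in bp bq br; have [c hc] := switch_three pq pr qr bp bq br.
    by exists (inr c).
  have bD : b \in B :\: transversal by rewrite inE bT.
  by exists (inl (exist _ b bD)); rewrite /= bp bq br.
- rewrite -(sqs_card sB) leq_mul2l /= card_sum card_sig.
  have -> : #|[pred b | b \in B :\: transversal]| = #|B :\: transversal| by apply: eq_card.
  have tB : transversal \subset B by apply/subsetP=> b; rewrite inE => /andP[].
  have := cardsD B transversal; rewrite (setIidPr tB) => ->.
  apply: (@leq_trans (#|B| - #|transversal| + #|transversal|)).
    by rewrite leq_add2l card_transversal.
  by rewrite subnK ?subset_leq_card.
Qed.

(** The cube can be read off the switched system, so different cubes give different systems. *)
Lemma switch_mem x y z w : (tquad x y z w \in switch) = (w == L x y z).
Proof.
apply/idP/eqP => [/setUP[]|->]; last by apply/setUP; right; apply/imsetP; exists (x, y, z).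
  rewrite inE => /andP[/negP nT bB]; case: nT; rewrite inE bB /=.
  by apply/existsP; exists x; apply/existsP; exists y; apply/existsP; exists z; apply/existsP; exists w.
by case/imsetP=> -[[x' y'] z'] _ /tquad_inj /= [-> -> -> ->].
Qed.
End Switch.

Lemma flex_many n a b m : flex n (2 ^ a * b.+1) -> 0 < a -> 128 * m <= (2 ^ a * b.+1) ^ 3 ->
  (2 ^ a) ^ m <= num_SQS n.
Proof.
case=> B [f [o [sB fi _ fB]]] a0 hm.
pose H := ({ffun 'I_a -> 'I_2} * 'I_b.+1)%type.
have [|g [g' gK g'K]] := @card_bij H 'I_(2 ^ a * b.+1).
  by rewrite card_prod card_ffun !card_ord.
pose F i x := f (i, g x).
have Fi i j x y : F i x = F j y -> i = j /\ x = y.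
  by move=> /fi [-> /(can_inj gK) ->].
have FB x y z : exists w, quad (F (inord 0) x) (F (inord 1) y) (F (inord 2) z) (F (inord 3) w) \in B.
  by have [w h] := fB (g x) (g y) (g z); exists (g' w); rewrite /F g'K.
have many := @pert_many a b m a0; rewrite card_X in many.
apply: leq_trans (many hm) _.
pose S (e : {ffun H * H * H -> {ffun 'I_a -> 'I_2}}) := switch B F (cube e).
rewrite -(card_in_imset (f := S)); last first.
  move=> e e' _ _ SS; apply: cube_pert => x y z; apply/eqP.
  by rewrite -(switch_mem B Fi) -/(S e') -SS /S (switch_mem B Fi).
apply: subset_leq_card; apply/subsetP=> _ /imsetP[e eP ->]; move: eP; rewrite inE => /andP[ce _].
rewrite inE; apply: (switch_sqs sB Fi FB).
- by move=> y z; apply: cube_inj1.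
- by move=> x z; apply: cube_inj2.
- by move=> x y; apply: cube_inj3.
Qed.

(** * The upper bound on the number of systems *)

Lemma quad4 (T : finType) (x y z w : T) : #|quad x y z w| = 4 ->
  w \notin [set x; y; z] /\ #|[set x; y; z]| = 3.
Proof.
rewrite /quad setUC cardsU1 => e.
have l3 : #|[set x; y; z]| <= 3 by rewrite !cardsU !cards1; lia.
by case: (w \notin _) e => //= e; [split|]; lia.
Qed.

Lemma sqs_quad_unique (T : finType) (B : {set {set T}}) x y z w w' : is_sqs B ->
  quad x y z w \in B -> quad x y z w' \in B -> w = w'.
Proof.
move=> sB qB qB'; have [wn c3] := quad4 (sqs_card4 sB qB).
have e : quad x y z w = quad x y z w'.
  by apply: (sqs_unique sB c3 qB qB'); rewrite /quad subsetUl.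
have : w \in quad x y z w' by rewrite -e in_quad eqxx !orbT.
rewrite in_quad; move: wn; rewrite !inE !negb_or => /andP[/andP[/negbTE-> /negbTE->] /negbTE->].
by move/eqP.
Qed.

Lemma num_SQS_le n : num_SQS n <= n ^ (n * n * n).
Proof.
(* The default is the first point of the triple: it is never the fourth point of a block, so it
   cannot be confused with one. *)
pose ph (B : {set {set 'I_n}}) : {ffun 'I_n * 'I_n * 'I_n -> 'I_n} :=
  [ffun c => odflt c.1.1 [pick w | quad c.1.1 c.1.2 c.2 w \in B]].
have sub B B' : is_sqs B -> is_sqs B' -> ph B = ph B' -> B \subset B'.
  move=> sB sB' e; apply/subsetP=> b bB; have b4 := sqs_card4 sB bB.
  have [x [y [z [w be]]]] : exists x y z w, b = quad x y z w.
    have : b = [set z in enum b] by apply/setP=> t; rewrite inE mem_enum.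
    have : size (enum b) = 4 by rewrite -cardE.
    case: (enum b) => [//|x [//|y [//|z [//|w [|//]]]]] _ ->.
    by exists x, y, z, w; apply/setP=> t; rewrite inE in_quad !inE.
  subst b; have [wn _] := quad4 b4.
  have := congr1 (fun f : {ffun 'I_n * 'I_n * 'I_n -> 'I_n} => f (x, y, z)) e.
  rewrite !ffunE /=; case: pickP => [w' w'B|/(_ w)]; last by rewrite bB.
  rewrite /= (sqs_quad_unique sB w'B bB); case: pickP => [w'' w''B /= ->|_ /= wx] //.
  by move: wn; rewrite wx !inE eqxx.
have ph_inj : {in [set B | is_SQS B] &, injective ph}.
  move=> B B'; rewrite !inE => sB sB' e; apply/eqP; rewrite eqEsubset.
  by rewrite (sub B B') // (sub B' B).
rewrite /num_SQS -(card_in_imset ph_inj); apply: leq_trans (max_card _) _.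
by rewrite card_ffun !card_prod !card_ord.
Qed.

(** * All orders *)

Definition admissible (n : nat) : bool := (n %% 6 == 2) || (n %% 6 == 4).

Variant order_case (n : nat) : Prop :=
  | OrderTwo of n = 2
  | OrderDouble u of n = 2 * u & admissible u
  | OrderQuad k of n = 8 * k.+1 + 2 & odd k.+1 || (4 <= k.+1) & admissible (2 * k.+1 + 2)
  | OrderTriple1 u of n = 1 + u.-1 * 3 & admissible u & u %% 4 = 0
  | OrderTriple2 r of n = 2 + 3 * (2 + 6 * r) & odd r & admissible (4 + 6 * r) & 0 < r & (4 + 6 * r) %% 8 = 6
  | OrderTriple4 r of n = 4 + 3 * (4 + 6 * r) & odd r & (8 + 6 * r) %% 8 = 2 & admissible (8 + 6 * r)
  | OrderTwelve u of n = 2 + u.-1 * 12 & admissible u.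

(** After the multiples of 4 and the residue 2 modulo 8 there remains 6 modulo 8. Modulo 36 this
    leaves 10 and 22 for 3u - 2, 26 and 34 (that is, 62 and 70 modulo 72) for 3u - 4 and 3u - 8, and
    2 and 14 for 12u - 10. *)
Lemma order_caseP n : admissible n -> order_case n.
Proof.
rewrite /admissible => an.
case: (altP (n %% 4 =P 0)) => [h4|h4].
  by apply: (@OrderDouble n n./2); rewrite /admissible; lia.
case: (altP (n %% 8 =P 2)) => h8.
  case: (ltnP n 3) => n3; first by apply: OrderTwo; lia.
  by apply: (@OrderQuad n (n %/ 8).-1); rewrite /admissible; lia.
case: (boolP ((n %% 36 == 10) || (n %% 36 == 22))) => h36.
  by apply: (@OrderTriple1 n (n %/ 3).+1); rewrite /admissible; lia.
case: (altP (n %% 72 =P 62)) => h62.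
  by apply: (@OrderTriple2 n ((n - 8) %/ 18)); rewrite /admissible; lia.
case: (altP (n %% 72 =P 70)) => h70.
  by apply: (@OrderTriple4 n ((n - 16) %/ 18)); rewrite /admissible; lia.
by apply: (@OrderTwelve n (n %/ 12).+1); rewrite /admissible; lia.
Qed.

Lemma embeds_triple2 r : odd r -> embeds (4 + 6 * r) (2 + 3 * (2 + 6 * r)).
Proof.
move=> ro; have e : ((3 * r).*2).+2 = 2 + 6 * r by lia.
have := @embeds_triple (3 * r) r 2; rewrite e addnA => h; apply: h => //; lia.
Qed.

Lemma embeds_triple4 r : embeds (8 + 6 * r) (4 + 3 * (4 + 6 * r)).
Proof.
have e : ((3 * r + 1).*2).+2 = 4 + 6 * r by lia.
have := @embeds_triple (3 * r + 1) r 4; rewrite e addnA => h; apply: h => //; lia.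
Qed.

Lemma sqs_exists n : admissible n -> sqs n.
Proof.
elim/ltn_ind: n => n IH an.
case: (order_caseP an) => [->|u e au|k e ko ak|u e au _|r e ro ar _ _|r e ro _ ar|u e au].
- exact: sqs2.
- rewrite e; apply: sqs_double; [apply: IH => //| |]; move: au an; rewrite /admissible; lia.
- by rewrite e; apply: sqs_quad => //; apply: IH => //; lia.
- by rewrite e; apply: sqs_3u2; [|apply: IH => //]; move: au an; rewrite /admissible; lia.
- by rewrite e; apply: (embeds_sqs (embeds_triple2 ro)); apply: IH => //; lia.
- by rewrite e; apply: (embeds_sqs (@embeds_triple4 r)); apply: IH => //; lia.
- by rewrite e; apply: sqs_12u10; [|apply: IH => //]; move: au an; rewrite /admissible; lia.
Qed.

Lemma flex_one n : sqs n -> 4 < n -> flex n 1.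
Proof.
case=> B sB n4; have n2 : 2 < n by lia.
pose q i (h : i < n) := Ordinal h.
have [||| b bB _] := @sqs_cover _ _ sB (Ordinal (ltnW (ltnW n2))) (Ordinal (ltnW n2)) (Ordinal n2) => //.
have b4 : 4 = #|b| by rewrite (sqs_card4 sB bB).
have [o ob] : exists o, o \notin b.
  have : 0 < #|~: b| by rewrite cardsCs setCK card_ord -b4; lia.
  by case/card_gt0P=> o; rewrite inE; exists o.
pose f (p : 'I_4 * 'I_1) : 'I_n := enum_val (cast_ord b4 p.1).
have fb p : f p \in b by apply: enum_valP.
have fi : injective f.
  by move=> [i x] [j y] /enum_val_inj/cast_ord_inj /= ->; rewrite !ord1.
exists B, f, o; split=> // [p|x y z]; first by apply: contraNneq ob => <-; apply: fb.
exists ord0; have -> : quad (f (inord 0, x)) (f (inord 1, y)) (f (inord 2, z)) (f (inord 3, ord0)) = b => //.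
apply/eqP; rewrite eqEcard -b4; apply/andP; split.
  by apply/subsetP=> t; rewrite in_quad => /or4P[] /eqP->.
have d i j u v : i < 4 -> j < 4 -> i != j -> f (inord i, u) != f (inord j, v).
  by move=> i4 j4 ij; apply: contraNneq (ord4_neq i4 j4 ij) => /fi/(congr1 fst) /= ->.
by rewrite /quad setUC cardsU1 cards3 ?d // !inE !negb_or !d.
Qed.

(* The order [2 ^ a * b] of the flexible cube keeps a large factor [2 ^ a] and at least the
   proportion [1 / R] of the points. *)
Definition flexible (R n : nat) : Prop := exists a b,
  [/\ b < 3 * 2 ^ a, flex n (2 ^ a * b.+1) & n <= R * (2 ^ a * b.+1)].

Lemma flexible_le R R' n : R <= R' -> flexible R n -> flexible R' n.
Proof.
move=> RR [a [b [b3 f h]]]; exists a, b; split=> //.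
by apply: leq_trans h _; rewrite leq_mul2r RR orbT.
Qed.

Lemma flexible_embeds R n N : N <= 3 * n -> embeds n N -> flexible R n -> flexible (3 * R) N.
Proof.
move=> Nn E [a [b [b3 f h]]]; exists a, b; split=> //; first exact: embeds_flex E f.
by apply: leq_trans Nn _; rewrite -mulnA leq_mul2l h orbT.
Qed.

Lemma flexible_one n R : sqs n -> 4 < n -> n <= R -> flexible R n.
Proof.
move=> sn n4 nR; exists 0, 0; split=> //; last by rewrite expn0 !muln1.
exact: flex_one.
Qed.

Lemma flexible_double n : admissible n -> n %% 4 = 0 -> 8 <= n -> flexible 32 n.
Proof.
rewrite /admissible => an n4 n8; pose u := n./2.
have au : admissible u by rewrite /admissible /u; lia.
have [||a [ua fa]] := @fact_even u; rewrite /u; try lia.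
have -> : n = 2 * u by rewrite /u; lia.
exists a, 0; rewrite muln1; split.
- by have := expn_gt0 2 a; lia.
- exact: flex_double (sqs_exists au) fa.
- move: ua; rewrite /u; lia.
Qed.

Lemma flexible_quad n : admissible n -> n %% 8 = 2 -> 26 <= n -> flexible 80 n.
Proof.
rewrite /admissible => an n8 n26; pose k := (n %/ 8).-1.
have [||a [ua fa]] := @fact_even (2 * k.+1); rewrite /k; try lia.
have -> : n = 8 * k.+1 + 2 by rewrite /k; lia.
exists a, 0; rewrite muln1; split.
- by have := expn_gt0 2 a; lia.
- by apply: flex_quad fa; [apply: sqs_exists; rewrite /admissible|]; rewrite /k; lia.
- move: ua; rewrite /k; lia.
Qed.

Lemma flexible_triple1 u : admissible u -> u %% 4 = 0 -> 8 <= u -> flexible 32 (1 + u.-1 * 3).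
Proof.
move=> au u4 u8; have au' := au; rewrite /admissible in au'; pose w := u./2.
have aw : admissible w by rewrite /admissible /w; lia.
have [||a [ua fa]] := @fact_even w; rewrite /w; try lia.
have f : flex u (2 ^ a).
  have -> : u = 2 * w by rewrite /w; lia.
  exact: flex_double (sqs_exists aw) fa.
exists a, 2; split.
- by have := expn_gt0 2 a; lia.
- by apply: flex_3u2 => //; lia.
- move: ua; rewrite /w; lia.
Qed.

Lemma flexible_all n : admissible n -> 8 <= n -> flexible 720 n.
Proof.
elim/ltn_ind: n => n IH an n8.
case: (leqP n 720) => n720; first by apply: flexible_one => //; [exact: sqs_exists|lia].
(* The embedded system has order 2 modulo 8 and so a cube from the construction 4u - 6. *)
have T4 r N : N = 4 + 3 * (4 + 6 * r) -> 720 <= 3 * N -> (8 + 6 * r) %% 8 = 2 -> admissible (8 + 6 * r) -> flexible 240 N.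
  move=> -> N7 r8 ar; apply: (flexible_embeds (R := 80)) (@embeds_triple4 r) _; first by lia.
  by apply: flexible_quad => //; lia.
case: (order_caseP an) => [e|u e au|k e ko ak|u e au u4|r e ro ar r0 r8|r e ro r8 ar|u e au].
- by move: n8; rewrite e.
- apply: (flexible_le (R := 32)) => //; apply: flexible_double => //.
  by move: an au; rewrite e /admissible; lia.
- by apply: (flexible_le (R := 80)) => //; apply: flexible_quad => //; lia.
- by rewrite e; apply: (flexible_le (R := 32)) => //; apply: flexible_triple1 => //; lia.
- rewrite e; apply: (flexible_embeds (R := 240)) (embeds_triple2 ro) _; first by lia.
  (* The order [4 + 6 * r] is 6 modulo 8 and 4 modulo 6, hence 10, 22 or 34 modulo 36: only 3u - 2
     and 3u - 8 can occur. *)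
  case: (order_caseP ar) => [e'|u e' au|k e' ko ak|u e' au u4|r' e' ro' _ _ _|r' e' ro' r8' ar'|u e' au]; try lia.
  + by move: au ar r8; rewrite /admissible; lia.
  + by rewrite e'; apply: (flexible_le (R := 32)) => //; apply: flexible_triple1 => //; lia.
  + by apply: (T4 r') => //; lia.
- by apply: (flexible_le (R := 240)) => //; apply: (T4 r) => //; lia.
- have u8 : 8 <= u by lia.
  have [|//|//|a [b [b3 f h]]] := IH u; first by lia.
  (* The factor 12 is split as 4 * 3; as [b.+1] grows by 3 and [2 ^ a] by 4, the bound on [b]
     persists. *)
  exists a.+2, (3 * b + 2); have e12 : 2 ^ a.+2 * (3 * b + 2).+1 = 2 ^ a * b.+1 * 12.
    by rewrite !expnS; lia.
  split; first by rewrite !expnS; lia.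
    by rewrite e12 e; apply: flex_12u10 => //; lia.
  by rewrite e12 e; lia.
Qed.

(** Here [q] is [2 ^ a]. From [b < 3 * 2 ^ a] one gets [n <= 3 * R * q ^ 2]; squaring and cancelling
    [n > (3 * R) ^ 2] leaves [n <= q ^ 4]. The constant 256 is twice 128, to absorb the rounding in
    [k ^ 3 %/ 128], harmless as [k >= 8]. *)
Lemma flexible_num R n : flexible R n -> 8 * R <= n -> (3 * R) ^ 2 < n ->
  exists q M, [/\ n <= q ^ 4, n ^ 3 <= 256 * R ^ 3 * M & q ^ M <= num_SQS n].
Proof.
move=> [a [b [b3 f h]]] nR8 nR; pose k := 2 ^ a * b.+1.
have R0 : 0 < R by case: R h nR8 nR => //; lia.
have k8 : 8 <= k by rewrite -(leq_pmul2l R0) mulnC (leq_trans nR8).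
have nq : n <= 3 * R * (2 ^ a) ^ 2.
  apply: leq_trans h _; rewrite (mulnC 3) -!mulnA leq_mul2l; apply/orP; right.
  by rewrite expnS expn1 mulnCA leq_mul2l b3 orbT.
have a0 : 0 < a.
  case: a nq {f b3 h k k8} => // nq; move: nR; rewrite expnS expn1; nia.
exists (2 ^ a), (k ^ 3 %/ 128); split.
- rewrite -(leq_pmul2l (m := n)); last by lia.
  apply: (leq_trans (leq_mul nq nq)); rewrite -mulnn in nR.
  rewrite (_ : _ * _ = 3 * R * (3 * R) * (2 ^ a) ^ 4); last by rewrite !expnS; lia.
  by rewrite leq_mul2r ltnW ?orbT.
- have : n ^ 3 <= R ^ 3 * k ^ 3 by rewrite -expnMn leq_exp2r.
  have : 8 ^ 3 <= k ^ 3 by rewrite leq_exp2r.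
  move=> k3 /leq_trans-> //; rewrite (mulnC 256) -mulnA leq_mul2l; apply/orP; right.
  by move: k3; move: (k ^ 3) => K; rewrite -[8 ^ 3]/512; lia.
- by apply: flex_many f a0 _; rewrite mulnC leq_divM.
Qed.

Lemma expn_pow m n : m ^ n = Nat.pow m n.
Proof. by elim: n => // n IH; rewrite expnS IH. Qed.

Lemma modulo_modn m d : 0 < d -> Nat.modulo m d = m %% d.
Proof.
move=> d0; have e := PeanoNat.Nat.div_mod_eq m d.
rewrite [in RHS]e -[(_ * _)%coq_nat]/(d * _) -[(_ + _)%coq_nat]/(_ + _) mulnC modnMDl modn_small //.
apply/ltP/PeanoNat.Nat.mod_upper_bound; lia.
Qed.

Lemma num_SQS_bounds : exists C n0 : nat, lt 0 C /\ forall n, le n0 n ->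
  Nat.modulo n 6 = 2 \/ Nat.modulo n 6 = 4 ->
  [/\ lt 1 n, lt 0 (num_SQS n), le (num_SQS n) (Nat.pow n (n * n * n)) &
    exists q M, [/\ le n (Nat.pow q 4), le (Nat.pow n 3) (C * M) &
      le (Nat.pow q M) (num_SQS n)]].
Proof.
exists (256 * 720 ^ 3), ((3 * 720) ^ 2).+1; split; first by apply/ltP; rewrite muln_gt0 expn_gt0.
move=> n /leP n0; rewrite modulo_modn // => n6.
have an : admissible n by apply/orP; case: n6 => ->; [left|right].
have n8 : 8 * 720 <= n.
  apply: leq_trans (ltnW n0); rewrite expnS expn1 -[3 * 720]/(3 * 720); lia.
have n1 : 8 <= n by apply: leq_trans n8; rewrite leq_pmulr.
have [q [M [h1 h2 h3]]] := flexible_num (flexible_all an n1) n8 n0.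
split.
- by apply/ltP; lia.
- apply/ltP; have [B sB] := sqs_exists an.
  by apply/card_gt0P; exists B; rewrite inE.
- by rewrite -expn_pow; apply/leP/num_SQS_le.
- by exists q, M; rewrite -!expn_pow; split; apply/leP.
Qed.

End Designs.

(** * Passage to logarithms *)

Lemma ln_INR_le m n : (0 < m)%nat -> (m <= n)%nat -> ln (INR m) <= ln (INR n).
Proof.
intros hm hmn; apply lt_0_INR in hm; apply le_INR in hmn.
destruct hmn as [h | ->]; [apply Rlt_le, ln_increasing; assumption | apply Rle_refl].
Qed.

Lemma ln_INR_pow m k : (0 < m)%nat -> ln (INR (Nat.pow m k)) = INR k * ln (INR m).
Proof.
intros hm; rewrite pow_INR, ln_pow; [reflexivity | apply lt_0_INR, hm].
Qed.

Theorem theorem4 :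
  exists (c1 c2 : R) (n0 : nat),
    0 < c1 /\ c1 <= c2 /\
    forall n : nat, (n0 <= n)%nat ->
      (Nat.modulo n 6 = 2%nat \/ Nat.modulo n 6 = 4%nat) ->
      c1 * (INR n ^ 3 * ln (INR n)) <= ln (INR (num_SQS n)) /\
      ln (INR (num_SQS n)) <= c2 * (INR n ^ 3 * ln (INR n)).
Proof.
destruct Designs.num_SQS_bounds as (C & n0 & C0 & bounds).
assert (C1 : 1 <= INR C) by (apply (le_INR 1), C0).
(* The 4 comes from [n <= q ^ 4] and [C] from [n ^ 3 <= C * M]; the upper constant is 1 because
   [num_SQS n] is at most [n ^ (n * n * n)]. *)
exists (/ (4 * INR C)), 1, n0; split; [apply Rinv_0_lt_compat; lra|]; split.
  rewrite <- Rinv_1; apply Rinv_le_contravar; lra.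
intros n hn n6; destruct (bounds n hn n6) as [n1 num0 upper (q & M & [nq nM lower])].
assert (q0 : (0 < q)%nat) by (destruct q; simpl in nq; lia).
assert (lnn : 0 <= ln (INR n)).
  rewrite <- ln_1; apply (ln_INR_le 1); lia.
split.
- apply ln_INR_le in nq; [|lia]; rewrite (ln_INR_pow q 4 q0) in nq.
  apply ln_INR_le in lower; [|apply Nat.neq_0_lt_0, Nat.pow_nonzero; lia].
  rewrite (ln_INR_pow q M q0) in lower.
  apply le_INR in nM; rewrite pow_INR, mult_INR in nM.
  apply Rle_trans with (2 := lower).
  apply Rmult_le_reg_l with (4 * INR C); [lra|].
  rewrite <- Rmult_assoc, Rinv_r, Rmult_1_l by lra.
  apply Rle_trans with (INR C * INR M * ln (INR n)).
    apply Rmult_le_compat_r; assumption.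
  replace (4 * INR C * (INR M * ln (INR q)))
    with (INR C * INR M * (INR 4 * ln (INR q))) by (simpl; ring).
  apply Rmult_le_compat_l; [apply Rmult_le_pos; apply pos_INR | exact nq].
- apply ln_INR_le in upper; [|exact num0]; rewrite ln_INR_pow in upper by lia.
  rewrite !mult_INR in upper; simpl; lra.
Qed.
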